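(* For every real $\gamma$ with $0<\gamma\leq 1$ and every real $\epsilon>0$ there exists a subfield $L$ of $\overline{\mathbb{Q}}$ such that $L$ is $\gamma$-Northcott but not $(\gamma-\epsilon)$-Bogomolov.
   Context: $\overline{\mathbb{Q}}$ denotes the field of algebraic numbers, $h(\cdot)$ the absolute logarithmic Weil height on $\overline{\mathbb{Q}}$, and $\deg\alpha=[\mathbb{Q}(\alpha):\mathbb{Q}]$ for $\alpha\in\overline{\mathbb{Q}}$. For a real number $\gamma$ (any sign) put $f_\gamma(\alpha)=(\deg\alpha)^{\gamma}h(\alpha)$. A subset $S\subset\overline{\mathbb{Q}}$ is called $\gamma$-Northcott if $\{\alpha\in S : f_\gamma(\alpha)\leq X\}$ is finite for every $X\in\mathbb{R}$. It is called $\gamma$-Bogomolov if $0$ is not an accumulation point of the set $f_\gamma(S)=\{f_\gamma(\alpha):\alpha\in S\}$ in the usual topology of $\mathbb{R}$. *)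

(* Defs.v *)
From HB Require Import structures.
From mathcomp Require Import all_boot all_order all_algebra all_field.
From mathcomp Require Import all_classical all_reals all_analysis.
Import Order.TTheory GRing.Theory Num.Theory.
Import numFieldNormedType.Exports.

Set Implicit Arguments.
Unset Strict Implicit.
Unset Printing Implicit Defensive.

Local Open Scope classical_set_scope.
Local Open Scope ring_scope.

(* The type algC of MathComp is the field of algebraic numbers; absolute values
   of its elements are again elements of algC. *)

(* minCpoly a is the monic minimal polynomial of a over Q. *)
Definition alg_deg (a : algC) : nat := (size (minCpoly a)).-1.

(* The minimal polynomial of a over Z: the primitive integer polynomial with
   positive leading coefficient that is a rational multiple of minCpoly a.
   (zprimitive takes out the signed content, so the result does not depend on
   the integer multiple chosen by rat_poly_scale.) *)
Definition min_zpoly (a : algC) : {poly int} :=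
  zprimitive (projT1 (rat_poly_scale (sval (minCpolyP a)))).

(* The roots in algC, listed with multiplicity. *)
Definition croots (p : {poly algC}) : seq algC :=
  sval (closed_field_poly_normal p).

Definition mahler_measure (p : {poly int}) : algC :=
  `|(lead_coef p)%:~R| *
  \prod_(z <- croots (map_poly intr p)) Num.max 1 `|z|.

(* The embedding of the real algebraic numbers into R, by Dedekind cuts. *)
Definition algC_to_real (R : realType) (x : algC) : R :=
  sup (@ratr R @` [set q : rat | ratr q <= x]).

(* Absolute logarithmic Weil height:
   h(a) = (log |a_0| + sum_i log max(1, |a_i|)) / d, where a_1, ..., a_d are the
   conjugates of a and a_0 is the leading coefficient of its minimal polynomial
   over Z. *)
Definition weil_height (R : realType) (a : algC) : R :=
  ln (algC_to_real R (mahler_measure (min_zpoly a))) / (alg_deg a)%:R.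

Definition weighted_height (R : realType) (gamma : R) (a : algC) : R :=
  (alg_deg a)%:R `^ gamma * weil_height R a.

Definition northcott (R : realType) (gamma : R) (S : set algC) : Prop :=
  forall X : R, finite_set [set a | S a /\ weighted_height gamma a <= X].

Definition bogomolov (R : realType) (gamma : R) (S : set algC) : Prop :=
  ~ limit_point (weighted_height gamma @` S) 0.

(* Main.v *)
(* The field L is the union of a tower of number fields K_{i+1} = K_i(theta), where
   theta^d = p with d, p prime, d much larger than D = [K_i : Q], and log p about
   d^(1 - gamma + epsilon/2). Then theta has height log p / d, so the
   (gamma - epsilon)-weighted heights of the theta's are positive and tend to 0.

   Let alpha in K_{i+1} \ K_i have degree n and integer minimal polynomial f with
   leading coefficient a and Mahler measure M, and let disc be the product of
   a^(2n-2) and of x - y over the ordered pairs of distinct roots of f. Write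
   alpha = sum_j c_j theta^j with c_j in K_i, and extend the p-adic valuation v to
   algC. Values of v on K_i have denominators at most D < d, so the nonzero terms
   c_j theta^j have distinct valuations; hence replacing theta by another d-th root
   of p moves alpha, relatively to its size, by an element of valuation at least
   1/(dD). So every root of f is v-close to d - 1 others, and disc, which is a
   rational integer by Galois invariance and Gauss' lemma, satisfies
   v(disc) >= n(d-1)/(dD). Since |disc| <= n!^2 M^(2n-2) (Leibniz expansion of a
   Vandermonde determinant), log M >= log p / (4D) - log n, which makes the
   gamma-weighted height of alpha large. Elements inside a fixed K_i are handled by
   Northcott's theorem for bounded degree. *)
Require Import Defs.
From HB Require Import structures.
From mathcomp Require Import all_boot all_order all_fingroup all_algebra all_field.
From mathcomp Require Import all_classical all_reals all_analysis.
From mathcomp Require Import ring lra zify.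
Import Order.TTheory GRing.Theory Num.Theory.
Import numFieldNormedType.Exports.

Set Implicit Arguments.
Unset Strict Implicit.
Unset Printing Implicit Defensive.

Local Open Scope classical_set_scope.
Local Open Scope ring_scope.

(** * Valuation rings of algC above a prime *)

(** A valuation v is handled only through its ring: [A x] stands for v(x) >= 0, and excluding
    [l%:R^-1] makes v(l) positive. *)
Definition subring_at (l : nat) (A : set algC) : Prop :=
  [/\ A 1, forall x y, A x -> A y -> A (x - y),
      forall x y, A x -> A y -> A (x * y) & ~ A (l%:R^-1)].

Definition valring (l : nat) (A : set algC) : Prop :=
  subring_at l A /\ forall x, A x \/ A x^-1.

Section Subrings.
Variables (l : nat) (A : set algC).
Hypothesis Asub : subring_at l A.

Lemma subring1 : A 1. Proof. by case: Asub. Qed.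
Lemma subringB x y : A x -> A y -> A (x - y). Proof. by case: Asub => _ + _ _; apply. Qed.
Lemma subringM x y : A x -> A y -> A (x * y). Proof. by case: Asub => _ _ + _; apply. Qed.
Lemma subring0 : A 0. Proof. by rewrite -(subrr 1); apply: subringB; apply: subring1. Qed.
Lemma subringN x : A x -> A (- x). Proof. by rewrite -sub0r; apply: subringB; apply: subring0. Qed.
Lemma subringD x y : A x -> A y -> A (x + y).
Proof. by move=> Ax Ay; rewrite -[y]opprK; apply: subringB => //; apply: subringN. Qed.
Lemma subringX x n : A x -> A (x ^+ n).
Proof.
move=> Ax; elim: n => [|n IH]; first by rewrite expr0; apply: subring1.
by rewrite exprS; apply: subringM.
Qed.
Lemma subring_nat n : A n%:R.
Proof. by elim: n => [|n IH]; [apply: subring0 | rewrite mulrS; apply: subringD => //; apply: subring1]. Qed.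
Lemma subring_int z : A z%:~R.
Proof. by case: z => n; [apply: subring_nat | rewrite NegzE mulrNz; apply/subringN/subring_nat]. Qed.
Lemma subring_sum (I : Type) (r : seq I) (P : pred I) F :
  (forall i, P i -> A (F i)) -> A (\sum_(i <- r | P i) F i).
Proof. by move=> AF; apply: big_ind => //; [apply: subring0 | apply: subringD]. Qed.
Lemma subring_prod (I : Type) (r : seq I) (P : pred I) F :
  (forall i, P i -> A (F i)) -> A (\prod_(i <- r | P i) F i).
Proof. by move=> AF; apply: big_ind => //; [apply: subring1 | apply: subringM]. Qed.
Definition adjoin_elt (x : algC) : set algC :=
  [set y | exists2 q : {poly algC}, forall i, A q`_i & y = q.[x]].

Lemma adjoin_elt_base x y : A y -> adjoin_elt x y.
Proof.
move=> Ay; exists y%:P; last by rewrite hornerC.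
by move=> i; rewrite coefC; case: eqP => _ //; apply: subring0.
Qed.

Lemma adjoin_elt_gen x : adjoin_elt x x.
Proof.
exists 'X; last by rewrite hornerX.
by move=> i; rewrite coefX; apply: subring_nat.
Qed.

Lemma adjoin_subring x : ~ adjoin_elt x l%:R^-1 -> subring_at l (adjoin_elt x).
Proof.
move=> nl; split => //; first exact/adjoin_elt_base/subring1.
- move=> _ _ [q Aq ->] [r Ar ->]; exists (q - r); last by rewrite hornerD hornerN.
  by move=> i; rewrite coefB; apply: subringB.
- move=> _ _ [q Aq ->] [r Ar ->]; exists (q * r); last by rewrite hornerM.
  by move=> i; rewrite coefM; apply: subring_sum => j _; apply: subringM.
Qed.

End Subrings.
Arguments adjoin_elt : clear implicits.

Lemma natV_notint (l : nat) : (1 < l)%N -> (l%:R^-1 : algC) \isn't a Num.int.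
Proof.
move=> l1; apply/negP => h; have l0 : (0 : algC) < l%:R by rewrite ltr0n ltnW.
have := norm_intr_ge1 h; rewrite invr_eq0 gt_eqF // => /(_ isT).
rewrite ger0_norm; last by rewrite invr_ge0 ltW.
move=> h1.
have : (1 : algC) < 1; last by rewrite ltxx.
by apply: le_lt_trans h1 _; rewrite invf_lt1 // ltr1n.
Qed.

Lemma int_subring (l : nat) : (1 < l)%N -> subring_at l [set x | x \is a Num.int].
Proof.
move=> l1; split => //=; last by apply/negP/natV_notint.
- by move=> x y; apply: rpredB.
- by move=> x y; apply: rpredM.
Qed.

(** * Maximal subrings without 1/l are valuation rings *)

Section Maximal.
Variables (l : nat) (A : set algC).
Hypothesis l_gt1 : (1 < l)%N.
Hypothesis Asub : subring_at l A.
Hypothesis Amax : forall B, subring_at l B -> A `<=` B -> B `<=` A.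

Let l_neq0 : (l%:R : algC) != 0.
Proof. by rewrite pnatr_eq0 -lt0n ltnW. Qed.

(** Otherwise [adjoin_elt A x] would be a subring still without 1/l, and maximality would force x
    into A. *)
Lemma maximal_adjoin x : ~ A x -> adjoin_elt A x l%:R^-1.
Proof.
move=> nAx; apply: contrapT => nl; apply: nAx.
have := Amax (adjoin_subring Asub nl); apply; last exact: adjoin_elt_gen Asub _.
by move=> y; apply: adjoin_elt_base Asub _ _.
Qed.

Lemma maximal_relation x : ~ A x ->
  exists2 q : {poly algC}, forall i, A q`_i & 1 = l%:R * q.[x].
Proof. by move=> /maximal_adjoin[q Aq qx]; exists q => //; rewrite -qx divff. Qed.

(** If u = 1 - l b had no inverse in A, [maximal_relation] at u^-1, cleared of denominators, would
    make a power of u a multiple of l in A. But every power of u is 1 minus such a multiple, so 1/l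
    would lie in A. *)
Lemma maximal_local b : A b -> A (1 - l%:R * b)^-1.
Proof.
move=> Ab; apply: contrapT => nA; have [q Aq] := maximal_relation nA.
set u := 1 - l%:R * b.
have u0 : u != 0 by apply: contra_notN nA => /eqP; rewrite /u => ->; rewrite invr0; apply: subring0 Asub.
have Au : A u.
  apply: (subringB Asub); first exact: subring1 Asub.
  by apply: (subringM Asub) => //; apply: subring_nat Asub _.
move=> rel.
have [c Ac] : exists2 c, A c & u ^+ (size q) = l%:R * c.
  exists (\sum_(i < size q) q`_i * u ^+ (size q - i)).
    apply: (subring_sum Asub) => i _; apply: (subringM Asub) => //; exact: (subringX Asub).
  rewrite -[LHS]mul1r [X in X * _]rel horner_coef -mulrA mulr_suml; congr (_ * _).
  apply: eq_bigr => i _; rewrite -mulrA exprVn; congr (_ * _).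
  rewrite mulrC -expfB_cond //; have := ltn_ord i; rewrite (negPf u0); lia.
have [e Ae ue] : exists2 e, A e & u ^+ size q = 1 - l%:R * e.
  elim: (size q) => [|k [e Ae IH]].
    by exists 0; [apply: subring0 Asub | rewrite mulr0 subr0].
  exists (b + e * u); last by rewrite exprSr IH /u; ring.
  by apply: (subringD Asub) => //; apply: (subringM Asub).
move=> cu; case: (Asub) => _ _ _; apply.
have -> : l%:R^-1 = c + e.
  apply: (mulfI l_neq0); rewrite divff // mulrDr -cu ue; ring.
exact: (subringD Asub).
Qed.

(** The constant term of q is moved to the left, where 1 - l q_0 is invertible in A by
    [maximal_local]. *)
Lemma maximal_relation_noconst x (q : {poly algC}) : (forall i, A q`_i) ->
  1 = l%:R * q.[x] ->
  exists2 r : {poly algC}, forall i, A r`_i &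
    [/\ 1 = l%:R * r.[x], r`_0 = 0 & (size r <= size q)%N].
Proof.
move=> Aq rel; have Au := maximal_local (Aq 0%N); set u := 1 - _ in Au.
have u0 : u != 0.
  apply/eqP => u0; case: (Asub) => _ _ _; apply.
  have -> : l%:R^-1 = q`_0; last exact: Aq.
  by apply: (mulfI l_neq0); rewrite divff //; apply/eqP; rewrite -subr_eq0 -/u u0.
exists (u^-1 *: (q - (q`_0)%:P)).
  move=> i; rewrite coefZ coefB coefC; apply: (subringM Asub) => //.
  by apply: (subringB Asub) => //; case: eqP => _ //; apply: subring0 Asub.
split.
- rewrite hornerZ hornerD hornerN hornerC mulrCA mulrBr -rel -/u mulVf //.
- by rewrite coefZ coefB coefC eqxx subrr mulr0.
- apply: leq_trans (size_scale_leq _ _) _; apply: leq_trans (size_polyD _ _) _.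
  rewrite geq_max leqnn size_polyN; apply: leq_trans (size_polyC_leq1 _) _.
  rewrite lt0n size_poly_eq0; apply: contraPneq rel => ->.
  by rewrite horner0 mulr0; apply/eqP/oner_neq0.
Qed.

(* If x^n is an l-multiple of lower powers of x, a relation for x of degree at
   least n can be lowered. *)
Lemma maximal_total x : A x \/ A x^-1.
Proof.
apply: contrapT => /not_orP[nx nxi].
have x0 : x != 0 by apply: contra_notN nx => /eqP ->; apply: subring0 Asub.
(* Descent on the total size of a relation for y and one for y^-1. Letting y vary allows the two to
   be swapped, so that q may be taken to be the longer one. *)
suff H : forall n y (q r : {poly algC}), (size q + size r <= n)%N -> y != 0 ->
    (forall i, A q`_i) -> (forall i, A r`_i) ->
    1 = l%:R * q.[y] -> 1 = l%:R * r.[y^-1] -> False.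
  have [q Aq rq] := maximal_relation nx; have [r Ar rr] := maximal_relation nxi.
  exact: (H _ x q r).
elim=> [|n IH] y q r.
  rewrite leqn0 addn_eq0 size_poly_eq0 => /andP[/eqP -> _] _ _ _ /eqP.
  by rewrite horner0 mulr0 oner_eq0.
wlog: y q r / (size r <= size q)%N.
  move=> W sz y0 Aq Ar rq rr; case/orP: (leq_total (size r) (size q)) => h.
    exact: (W y q r).
  apply: (W y^-1 r q) => //; rewrite ?invr_eq0 ?invrK // addnC //.
move=> rleq sz y0 Aq Ar rq rr.
have [r' Ar' [rr' r'0 szr']] := maximal_relation_noconst Ar rr.
have q0 : q != 0 by apply: contraPneq rq => ->; rewrite horner0 mulr0; apply/eqP/oner_neq0.
pose k := (size q).-1.
have szq : size q = k.+1 by rewrite /k prednK // lt0n size_poly_eq0.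
(* Multiplying the relation for y^-1 by y^k expresses y^k through lower powers, as r' has no
   constant term. Substituting this for the leading power in q gives the shorter s. *)
pose s := \poly_(j < k) (q`_j + l%:R * q`_k * r'`_(k - j)).
apply: (IH y s r) => //.
- have : (size s <= k)%N by apply: size_poly.
  by move: sz; rewrite szq; lia.
- move=> i; rewrite coef_poly; case: ifP => _; last exact: subring0 Asub.
  apply: (subringD Asub) => //; apply: (subringM Asub) => //; apply: (subringM Asub) => //.
  exact: (subring_nat Asub).
- rewrite [LHS]rq; congr (_ * _).
  have yk : y ^+ k = l%:R * \sum_(j < k) r'`_(k - j) * y ^+ j.
    rewrite -[LHS]mul1r [X in X * _]rr' -mulrA; congr (_ * _).
    rewrite (@horner_coef_wide _ k.+1); last by rewrite -szq; apply: leq_trans szr' _.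
    rewrite big_ord_recl r'0 mul0r add0r mulr_suml (reindex_inj rev_ord_inj) /=.
    apply: eq_bigr => j _; have jk := ltn_ord j.
    rewrite /bump /= add1n subnSK // -mulrA; congr (_ * _).
    rewrite exprVn mulrC -expfB_cond; last by rewrite (negPf y0) leq_subr.
    by congr (y ^+ _); lia.
  rewrite /s horner_poly horner_coef szq big_ord_recr /= yk.
  rewrite mulrA [q`_k * _]mulrC mulr_sumr -big_split /=.
  by apply: eq_bigr => j _; rewrite mulrDl mulrA.
Qed.

End Maximal.

Lemma valring_exists (l : nat) : (1 < l)%N -> exists A, valring l A.
Proof.
move=> l1; have Zs := int_subring l1.
pose P (A : set algC) := A = set0 \/ subring_at l A.
have [|A [PA Amax]] := @Zorn_bigcup algC P.
  move=> F FP Ftot; case: (pselect (exists2 X, F X & subring_at l X)); last first.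
    move=> nX; left; rewrite -subset0 => x [X FX Xx]; case: (FP X FX) => [X0|sX].
      by rewrite X0 in Xx.
    by apply: nX; exists X.
  move=> [X0 FX0 sX0]; right.
  have sF X x : F X -> X x -> subring_at l X.
    by move=> FX Xx; case: (FP X FX) => // X00; rewrite X00 in Xx.
  have two x y : (\bigcup_(X in F) X) x -> (\bigcup_(X in F) X) y ->
      exists2 X, F X & X x /\ X y.
    move=> [X FX Xx] [Y FY Yy]; case: (Ftot X Y FX FY) => h.
      by exists Y => //; split => //; apply: h.
    by exists X => //; split => //; apply: h.
  split.
  - by exists X0 => //; apply: subring1 sX0.
  - move=> x y Ux Uy; have [X FX [Xx Xy]] := two _ _ Ux Uy.
    by exists X => //; apply: (subringB (sF _ _ FX Xx)).
  - move=> x y Ux Uy; have [X FX [Xx Xy]] := two _ _ Ux Uy.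
    by exists X => //; apply: (subringM (sF _ _ FX Xx)).
  - by move=> [X FX Xl]; case: (sF _ _ FX Xl).
have sA : subring_at l A.
  case: PA => // A0; exfalso; apply: (Amax [set x | x \is a Num.int]); last by right.
  rewrite A0; split; first by move=> ?.
  by move=> /(_ 0); apply; apply: rpred0.
exists A; split => //; apply: (maximal_total l1) => // B sB AB x Bx.
apply: contrapT => nAx; apply: (Amax B); last by right.
by split => // BA; apply/nAx/BA.
Qed.

(** * Valuations through units and the maximal ideal *)

Definition vunit (A : set algC) (x : algC) : Prop := [/\ x != 0, A x & A x^-1].

Definition vmax (A : set algC) (x : algC) : Prop := A x /\ ~ vunit A x.

(* The valuation of x lies in (1/e)Z for some 0 < e <= D. *)
Definition vexp (l : nat) (A : set algC) (D : nat) (x : algC) : Prop :=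
  exists e (z : int), [/\ (0 < e)%N, (e <= D)%N & vunit A (x ^+ e / l%:R ^ z)].

(** Its valuation is - min(0, v x): it cancels the pole of x if there is one. *)
Definition vscale (A : set algC) (x : algC) : algC :=
  if pselect (A x) then 1 else x^-1.

(* With v the valuation, v (vdist a b) = v (a - b) - min(0, v a) - min(0, v b). *)
Definition vdist (A : set algC) (a b : algC) : algC :=
  (a - b) * vscale A a * vscale A b.

Section Valuation.
Variables (l : nat) (A : set algC).
Hypothesis lpr : prime l.
Hypothesis Aval : valring l A.

Let Asub : subring_at l A. Proof. by case: Aval. Qed.

Let l_neq0 : (l%:R : algC) != 0.
Proof. by rewrite pnatr_eq0 -lt0n prime_gt0. Qed.

Lemma vunit1 : vunit A 1.
Proof. by split; rewrite ?invr1 ?oner_eq0 //; apply: subring1 Asub. Qed.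
Lemma vunitM x y : vunit A x -> vunit A y -> vunit A (x * y).
Proof.
move=> [x0 Ax Ax'] [y0 Ay Ay']; split; first by rewrite mulf_neq0.
  exact: (subringM Asub).
by rewrite invfM; apply: (subringM Asub).
Qed.
Lemma vunitV x : vunit A x -> vunit A x^-1.
Proof. by move=> [x0 Ax Ax']; split; rewrite ?invr_eq0 ?invrK. Qed.
Lemma vunitVE x : vunit A x^-1 -> vunit A x.
Proof. by move=> /vunitV; rewrite invrK. Qed.
Lemma vunitX x n : vunit A x -> vunit A (x ^+ n).
Proof.
move=> ux; elim: n => [|n IH]; first by rewrite expr0; apply: vunit1.
by rewrite exprS; apply: vunitM.
Qed.
Lemma vunitN x : vunit A x -> vunit A (- x).
Proof. by move=> [x0 Ax Ax']; split; rewrite ?oppr_eq0 ?invrN //; apply: (subringN Asub). Qed.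

Lemma vunit_exp x n : (0 < n)%N -> vunit A (x ^+ n) -> vunit A x.
Proof.
case: n => // n _ [xn0 Axn Axn']; have x0 : x != 0 by move: xn0; rewrite expf_eq0.
case: Aval => _ tot; case: (tot x) => Ax.
  split=> //; have -> : x^-1 = x ^+ n * (x ^+ n.+1)^-1.
    by rewrite exprS invfM mulrCA divff ?mulr1 // expf_neq0.
  by apply: (subringM Asub) => //; apply: (subringX Asub).
split=> //; have -> : x = x^-1 ^+ n * (x ^+ n.+1).
  by rewrite exprS mulrCA -exprMn mulVf // expr1n mulr1.
by apply: (subringM Asub) => //; apply: (subringX Asub).
Qed.

Lemma vunit_root1 x n : (0 < n)%N -> x ^+ n = 1 -> vunit A x.
Proof. by move=> n0 xn; apply: (vunit_exp n0); rewrite xn; apply: vunit1. Qed.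

Lemma vmax0 : vmax A 0.
Proof. by split; [apply: subring0 Asub | case; rewrite eqxx]. Qed.

Lemma vmaxM x y : A x -> vmax A y -> vmax A (x * y).
Proof.
move=> Ax [Ay ny]; split; first exact: (subringM Asub).
move=> [+ _ Ai]; rewrite mulf_eq0 => /norP[x0 y0]; apply: ny; split => //.
have -> : y^-1 = x * (x * y)^-1 by rewrite invfM mulrA divff // mul1r.
exact: (subringM Asub).
Qed.

Lemma val_total x y : A (x / y) \/ A (y / x).
Proof. by case: Aval => _ /(_ (x / y)); rewrite invf_div. Qed.

Lemma vmaxD x y : vmax A x -> vmax A y -> vmax A (x + y).
Proof.
wlog Axy : x y / A (x / y).
  move=> W mx my; case: (val_total x y) => h; first exact: W.
  by rewrite addrC; apply: W.
move=> mx my; have [->|y0] := eqVneq y 0; first by rewrite addr0.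
have -> : x + y = (x / y + 1) * y by rewrite mulrDl divfK // mul1r.
by apply: vmaxM => //; apply: (subringD Asub) => //; apply: subring1 Asub.
Qed.

Lemma vmax_sum (I : Type) (r : seq I) (P : pred I) F :
  (forall i, P i -> vmax A (F i)) -> vmax A (\sum_(i <- r | P i) F i).
Proof. by move=> AF; apply: big_ind => //; [apply: vmax0 | apply: vmaxD]. Qed.

Lemma vunitD x y : vunit A x -> vmax A y -> vunit A (x + y).
Proof.
move=> ux my; have [x0 Ax Ax'] := ux; apply: contrapT => nu.
have mxy : vmax A (x + y) by split=> //; apply: (subringD Asub) => //; case: my.
have : vmax A (x + y + -1 * y).
  by apply: vmaxD => //; apply: vmaxM => //; apply/(subringN Asub)/(subring1 Asub).
by rewrite mulN1r addrK => -[].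
Qed.

Lemma vmax_l : vmax A l%:R.
Proof. by split; [apply: subring_nat Asub _ | case=> _ _; case: Asub]. Qed.

(** A non-unit n would lie in the maximal ideal together with l, and Bezout would put 1 there. *)
Lemma vunit_nat n : coprime l n -> vunit A n%:R.
Proof.
move=> co; apply: contrapT => nu.
have mn : vmax A n%:R by split=> //; apply: subring_nat Asub _.
have n0 : (0 < n)%N.
  case: n co {nu mn} => //; rewrite /coprime gcdn0 => /eqP l1.
  by move: lpr; rewrite l1.
have := Bezoutr n (prime_gt0 lpr) => -[a _]; rewrite gcdnC (eqP co) => /dvdnP[b eb].
have m1 : vmax A (b%:R * l%:R - a%:R * n%:R).
  rewrite -mulNr; apply: vmaxD; apply: vmaxM => //.
  - exact: subring_nat Asub _.
  - exact: vmax_l.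
  - exact/(subringN Asub)/(subring_nat Asub).
by move: m1; rewrite -!natrM -eb natrD addrK => -[_]; case; apply: vunit1.
Qed.

Lemma vunit_lz (z : int) : vunit A (l%:R ^ z) -> z = 0.
Proof.
have main n : vunit A (l%:R ^+ n.+1) -> False.
  by move/(vunit_exp (ltn0Sn n)); case: vmax_l.
case: z => [[//|n]|n]; first by rewrite -exprnP => /main.
by rewrite NegzE -exprz_inv; rewrite -exprnP exprVn => /vunitVE/main.
Qed.

Lemma vexp_rat (q : rat) : q != 0 -> exists z : int, vunit A (ratr q / l%:R ^ z).
Proof.
have natP n : (0 < n)%N -> exists k, vunit A (n%:R / l%:R ^+ k).
  move=> n0; have [m co ->] := pfactor_coprime lpr n0.
  by exists (logn l n); rewrite natrM natrX mulfK ?expf_neq0 //; apply: vunit_nat.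
have intP (m : int) : m != 0 -> exists k, vunit A (m%:~R / l%:R ^+ k).
  case: m => [n n0|n _]; first by apply: natP; case: n n0.
  have [k uk] := natP n.+1 isT; exists k.
  by rewrite NegzE mulrNz mulNr; apply: vunitN.
move=> q0; have [|a ua] := intP (numq q); first by rewrite numq_eq0.
have [b ub] := intP _ (denq_neq0 q); exists (a%:Z - b%:Z).
have -> : ratr q / l%:R ^ (a%:Z - b%:Z) =
    ((numq q)%:~R / l%:R ^+ a) * ((denq q)%:~R / l%:R ^+ b)^-1 :> algC.
  by rewrite expfzDr // -exprz_inv -!exprnP /ratr invf_div exprVn invfM; field;
     rewrite ?expf_neq0 // intr_eq0 denq_neq0.
by apply: vunitM => //; apply: vunitV.
Qed.

Lemma dominant_le (I : eqType) (t : I -> algC) (s : seq I) :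
  has (fun i => t i != 0) s ->
  exists k, [/\ k \in s, t k != 0 & forall i, i \in s -> A (t i / t k)].
Proof.
elim: s => //= i s IH; case: (boolP (has _ s)) => [/IH[k [ks k0 kmax]] _|]; last first.
  rewrite -all_predC orbF => /allP all0 i0; exists i; rewrite mem_head; split=> // j.
  rewrite inE => /orP[/eqP ->|/all0 /= /negPn/eqP ->].
    by rewrite divff //; apply: subring1 Asub.
  by rewrite mul0r; apply: subring0 Asub.
case: (val_total (t i) (t k)) => h.
  exists k; split=> //; first by rewrite inE ks orbT.
  by move=> j; rewrite inE => /orP[/eqP ->|/kmax].
have [i0|i0] := eqVneq (t i) 0.
  exists k; split=> //; first by rewrite inE ks orbT.
  move=> j; rewrite inE => /orP[/eqP ->|/kmax//].
  by rewrite i0 mul0r; apply: subring0 Asub.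
exists i; rewrite mem_head; split=> // j; rewrite inE => /orP[/eqP ->|/kmax js].
  by rewrite divff //; apply: subring1 Asub.
have -> : t j / t i = (t j / t k) * (t k / t i) by rewrite mulrA divfK.
exact: (subringM Asub).
Qed.

(** The nonzero terms have pairwise distinct valuations, so the least one, given by [dominant_le],
    is attained only once. *)
Lemma dominant (I : finType) (t : I -> algC) :
  (exists i, t i != 0) ->
  (forall i j, i != j -> t i != 0 -> t j != 0 -> ~ vunit A (t i / t j)) ->
  exists2 k, t k != 0 & forall i, i != k -> vmax A (t i / t k).
Proof.
move=> [i i0] tP; have [|k [_ k0 kmax]] := @dominant_le _ t (enum I).
  by apply/hasP; exists i; rewrite ?mem_enum.
exists k => // j jk; have Aj : A (t j / t k) by apply: kmax; rewrite mem_enum.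
have [j0|j0] := eqVneq (t j) 0; first by rewrite j0 mul0r; apply: vmax0.
by split=> //; apply: tP.
Qed.

(** All terms but the k-th are negligible, so the sum has the valuation of [t k]. The unit factors
    serve for conjugates, whose terms differ by powers of roots of unity. *)
Lemma dominant_sum (I : finType) (t u : I -> algC) k : t k != 0 ->
  (forall i, i != k -> vmax A (t i / t k)) -> (forall i, vunit A (u i)) ->
  vunit A ((\sum_i t i * u i) / t k).
Proof.
move=> k0 kmax uu; rewrite mulr_suml (bigD1 k) //=.
apply: vunitD; first by rewrite mulrAC divff // mul1r.
apply: vmax_sum => i ik; rewrite mulrAC mulrC; apply: vmaxM; first by case: (uu i).
exact: kmax.
Qed.

Lemma sum_neq0 (I : finType) (t : I -> algC) :
  (exists i, t i != 0) ->
  (forall i j, i != j -> t i != 0 -> t j != 0 -> ~ vunit A (t i / t j)) ->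
  \sum_i t i != 0.
Proof.
move=> t0 tP; have [k k0 kmax] := dominant t0 tP.
have [+ _ _] := dominant_sum k0 kmax (fun=> vunit1).
by under eq_bigr do rewrite mulr1; apply: contra => /eqP ->; rewrite mul0r.
Qed.

(** A Newton polygon argument: since the terms q_i x^i sum to 0, two nonzero ones share a valuation
    by [sum_neq0]. Then (i - j) v(x) is the valuation of a nonzero rational number, an integer when
    v(l) = 1. *)
Lemma vexp_alg (D : nat) (q : {poly rat}) x : x != 0 -> q != 0 ->
  (size q <= D.+1)%N -> root (map_poly ratr q) x -> vexp l A D x.
Proof.
move=> x0 q0 sq; rewrite /root horner_coef size_map_poly => rq.
pose t (i : 'I_(size q)) : algC := ratr q`_i * x ^+ i.
have t_eq i : t i != 0 -> q`_i != 0 by apply: contraNneq => h; rewrite /t h raddf0 mul0r.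
have [i [j [ij ti tj u]]] : exists i j, [/\ i != j, t i != 0, t j != 0 & vunit A (t i / t j)].
  apply: contrapT => H.
  have : \sum_i t i != 0.
    apply: sum_neq0.
      have sq0 : ((size q).-1 < size q)%N by rewrite prednK // lt0n size_poly_eq0.
      exists (Ordinal sq0); rewrite /t /= mulf_neq0 ?expf_neq0 //.
      by rewrite fmorph_eq0 -lead_coefE lead_coef_eq0.
    by move=> i j ij ti tj u; apply: H; exists i, j.
  move=> /eqP; apply; rewrite -[RHS](eqP rq); apply: eq_bigr => i _.
  by rewrite /t coef_map.
wlog ltij : i j ij ti tj u / (j < i)%N.
  move=> W; case: (ltngtP j i) => h; first exact: (W i j).
    by apply: (W j i) => //; rewrite 1?eq_sym //; rewrite -invf_div; apply: vunitV.
  by move: ij; rewrite -val_eqE /= h eqxx.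
have [z uz] : exists z : int, vunit A (ratr (q`_i / q`_j) / l%:R ^ z).
  by apply: vexp_rat; rewrite mulf_neq0 ?invr_eq0 ?t_eq.
exists (i - j)%N, (- z); split.
- by rewrite subn_gt0.
- by have := ltn_ord i; lia.
have -> : x ^+ (i - j) / l%:R ^ (- z) = (t i / t j) * (ratr (q`_i / q`_j) / l%:R ^ z)^-1.
  have xij : x ^+ i = x ^+ (i - j) * x ^+ j by rewrite -exprD subnK // ltnW.
  have h0 k : q`_k != 0 -> (ratr q`_k : algC) != 0 by rewrite fmorph_eq0.
  have lz : (l%:R ^ z : algC) != 0 by rewrite expfz_neq0.
  rewrite /t xij fmorph_div -invr_expz; field.
  by rewrite lz expf_neq0 // !h0 ?t_eq.
by apply: vunitM => //; apply: vunitV.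
Qed.

(** A positive element of (1/e)Z is at least 1/e, hence at least 1/N. *)
Lemma vmax_pow (N : nat) x : vmax A x -> vexp l A N x -> A (x ^+ N / l%:R).
Proof.
move=> [Ax nx] [e [z [e0 eN u]]].
have xe : x ^+ e = (x ^+ e / l%:R ^ z) * l%:R ^ z by rewrite divfK // expfz_neq0.
move: (_ / _) u xe => w u; case: z => [[|n]|n] xe.
- by case: nx; apply: (vunit_exp e0); rewrite xe mulr1.
- have -> : x ^+ N / l%:R = x ^+ (N - e) * (w * l%:R ^+ n).
    rewrite -{1}(subnK eN) exprD xe -exprnP exprSr; field.
    exact: l_neq0.
  apply: (subringM Asub); first exact: (subringX Asub).
  by apply: (subringM Asub); [case: u | apply/(subringX Asub)/(subring_nat Asub)].
- case: nx; apply: (vunit_exp e0); have [w0 Aw Aw'] := u; split.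
    by rewrite xe mulf_neq0 // expfz_neq0.
    exact: (subringX Asub).
  rewrite xe invfM; apply: (subringM Asub) => //.
  by rewrite NegzE -invr_expz invrK -exprnP; apply/(subringX Asub)/(subring_nat Asub).
Qed.

(** The ultrametric inequality: the summand of smaller valuation factors out of the sum. *)
Lemma lpow_add (N : nat) x y : A x -> A y -> A (x ^+ N / l%:R) -> A (y ^+ N / l%:R) ->
  A ((x + y) ^+ N / l%:R).
Proof.
wlog Axy : x y / A (x / y).
  move=> W Ax Ay Ax' Ay'; case: (val_total x y) => h; first exact: W.
  by rewrite addrC; apply: W.
move=> Ax Ay Ax' Ay'; have [->|y0] := eqVneq y 0; first by rewrite addr0.
have -> : x + y = (x / y + 1) * y by rewrite mulrDl divfK // mul1r.
rewrite exprMn -mulrA; apply: (subringM Asub) => //; apply: (subringX Asub).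
by apply: (subringD Asub) => //; apply: subring1 Asub.
Qed.

Lemma lpow_sum (N : nat) (I : Type) (r : seq I) (P : pred I) F :  (0 < N)%N ->
  (forall i, P i -> A (F i)) -> (forall i, P i -> A (F i ^+ N / l%:R)) ->
  A ((\sum_(i <- r | P i) F i) ^+ N / l%:R).
Proof.
move=> N0 AF AF'.
suff [] : A (\sum_(i <- r | P i) F i) /\ A ((\sum_(i <- r | P i) F i) ^+ N / l%:R) by [].
apply: (big_ind (fun x => A x /\ A (x ^+ N / l%:R))).
- by rewrite expr0n -[N]prednK //= mul0r; split; apply: subring0 Asub.
- by move=> x y [Ax Ax'] [Ay Ay']; split; [apply: (subringD Asub) | apply: lpow_add].
- by move=> i Pi; split; [apply: AF | apply: AF'].
Qed.

Lemma vscale1 a : A a -> vscale A a = 1.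
Proof. by rewrite /vscale; case: pselect. Qed.

Lemma vscaleV a : ~ A a -> vscale A a = a^-1.
Proof. by rewrite /vscale; case: pselect. Qed.

Lemma vscale_in a : A (vscale A a).
Proof.
rewrite /vscale; case: pselect => Aa /=; first exact: subring1 Asub.
by case: Aval => _ /(_ a)[].
Qed.

Lemma vscale_mul a : A (a * vscale A a).
Proof.
rewrite /vscale; case: pselect => Aa /=; first by rewrite mulr1.
have [->|a0] := eqVneq a 0; first by rewrite mul0r; apply: subring0 Asub.
by rewrite divff //; apply: subring1 Asub.
Qed.

Lemma vscale_neq0 a : vscale A a != 0.
Proof.
rewrite /vscale; case: pselect => Aa /=; first exact: oner_neq0.
by rewrite invr_eq0; apply: contra_notN Aa => /eqP ->; apply: subring0 Asub.
Qed.

Lemma vdist_in a b : A (vdist A a b).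
Proof.
have -> : vdist A a b = a * vscale A a * vscale A b - vscale A a * (b * vscale A b).
  by rewrite /vdist; ring.
by apply: (subringB Asub); apply: (subringM Asub); (apply: vscale_in || apply: vscale_mul).
Qed.

(* A root z outside A is divided out as (x/z - 1) (z q), a root inside as (x - z) q. *)
Lemma gauss_roots (a : algC) (s : seq algC) :
  (forall i, A (a *: \prod_(z <- s) ('X - z%:P))`_i) ->
  A (a * \prod_(z <- s) (vscale A z)^-1).
Proof.
elim: s a => [|z s IH] a; first by rewrite !big_nil => /(_ 0%N); rewrite coefZ coef1 mulr1.
rewrite !big_cons; set q := \prod_(j <- s) _ => Af.
have {}Af i : A ((a *: (q * 'X) - a *: (z *: q))`_i).
  by have := Af i; rewrite mulrBl scalerBr mul_polyC commr_polyX.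
rewrite /vscale; case: pselect => Az /=; rewrite ?invr1 ?mul1r.
  apply: IH => i; rewrite -/q.
  suff H : forall k i, (size q <= i + k)%N -> A ((a *: q)`_i).
    by apply: (H (size q)); rewrite leq_addl.
  elim=> [|k IHk] j.
    by rewrite addn0 => h; rewrite coefZ nth_default // mulr0; apply: subring0 Asub.
  rewrite -addSnnS => h.
  have -> : (a *: q)`_j = (a *: (q * 'X) - a *: (z *: q))`_j.+1 + z * (a *: q)`_j.+1.
    by rewrite coefB !coefZ coefMX /=; ring.
  by apply: (subringD Asub) => //; apply: (subringM Asub) => //; apply: IHk.
rewrite invrK mulrA; apply: IH => i; rewrite -/q.
have z0 : z != 0 by apply: contra_notN Az => /eqP ->; apply: subring0 Asub.
have Az' : A z^-1 by case: Aval => _ /(_ z)[].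
elim: i => [|i IHi].
  have -> : ((a * z) *: q)`_0 = - (a *: (q * 'X) - a *: (z *: q))`_0.
    by rewrite coefB !coefZ coefMX /=; ring.
  exact: (subringN Asub).
have -> : ((a * z) *: q)`_i.+1 =
    ((a * z) *: q)`_i * z^-1 - (a *: (q * 'X) - a *: (z *: q))`_i.+1.
  rewrite coefB !coefZ coefMX /=; field; exact: z0.
by apply: (subringB Asub) => //; apply: (subringM Asub).
Qed.

End Valuation.

(** If a prime l divides the denominator of x, with cofactor m, then the numerator a is a unit in
    any valuation ring above l, and x m / a = 1/l would lie in that ring. *)
Lemma rat_integral (x : algC) : x \in Crat ->
  (forall l A, prime l -> valring l A -> A x) -> x \is a Num.int.
Proof.
move=> /CratP[q ->] Ax; apply: contrapT => nint.
have d1 : (1 < `|denq q|)%N.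
  rewrite ltn_neqAle absz_gt0 denq_neq0 andbT; apply: contra_notN nint => /eqP d1.
  by rewrite Cint_rat Qint_def -absz_denq -d1.
set l := pdiv `|denq q|; have lpr : prime l by apply: pdiv_prime.
have [A Aval] := valring_exists (prime_gt1 lpr).
have Asub : subring_at l A by case: Aval.
have l0 : (l%:R : algC) != 0 by rewrite pnatr_eq0 -lt0n prime_gt0.
have co : coprime l `|numq q|.
  by apply: (@coprime_dvdl _ `|denq q|); [apply: pdiv_dvd | rewrite coprime_sym coprime_num_den].
have [un An Ain] := vunit_nat lpr Aval co.
have [m dm] : exists m, `|denq q|%N = (m * l)%N by apply/dvdnP/pdiv_dvd.
have [_ _ _] := Asub; apply.
have Aqd : A (ratr q * m%:R / (`|numq q|%N)%:R).
  by apply: (subringM Asub) => //; apply: (subringM Asub); [apply: Ax lpr Aval | apply: subring_nat Asub _].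
have eN : (numq q)%:~R = ratr q * (m * l)%:R :> algC.
  by rewrite -dm -[(`|denq q|)%:R]/((`|denq q|%N)%:~R) absz_denq /ratr divfK // intr_eq0 denq_neq0.
have [e|e] : (numq q)%:~R = (`|numq q|%N)%:R :> algC \/ (numq q)%:~R = - (`|numq q|%N)%:R :> algC.
- by case: (numq q) => n; [left | right; rewrite NegzE mulrNz].
- have -> : l%:R^-1 = ratr q * m%:R / (`|numq q|%N)%:R :> algC; last by [].
  by apply: (mulIf l0); rewrite mulVf // mulrAC -[_ * m%:R * _]mulrA -natrM -eN e divff.
- have -> : l%:R^-1 = - (ratr q * m%:R / (`|numq q|%N)%:R) :> algC; last exact: (subringN Asub).
  by apply: (mulIf l0); rewrite mulVf // mulNr mulrAC -[_ * m%:R * _]mulrA -natrM -eN e mulNr opprK divff.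
Qed.

(** * Conjugates in a Kummer extension of prime degree *)

Section Kummer.
Variables (l d D : nat) (A : set algC) (th : algC).
Hypotheses (lpr : prime l) (dpr : prime d) (Dd : (D < d)%N).
Hypotheses (Aval : valring l A) (thd : th ^+ d = l%:R).

Let Asub : subring_at l A. Proof. by case: Aval. Qed.

Let l_neq0 : (l%:R : algC) != 0.
Proof. by rewrite pnatr_eq0 -lt0n prime_gt0. Qed.

Lemma radical_neq0 : th != 0.
Proof.
apply: contraTneq isT => t0; move/eqP: thd.
by rewrite t0 expr0n gtn_eqF ?prime_gt0 // eq_sym (negPf l_neq0).
Qed.

Lemma radical_exp i e : (th ^+ i) ^+ (e * d) = l%:R ^+ (i * e).
Proof. by rewrite -exprM mulnA mulnC exprM thd. Qed.

(* Valuations of x and y lie in (1/e)Z with e <= D, and d is prime to e. *)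
Lemma kummer_nonassoc x y i j : x != 0 -> y != 0 -> vexp l A D (x / y) ->
  (i < d)%N -> (j < d)%N -> i != j -> ~ vunit A ((x * th ^+ i) / (y * th ^+ j)).
Proof.
move=> x0 y0 [e [z [e0 eD u1]]] id jd ij u2.
have u3 : vunit A (l%:R ^ (z * d%:Z + (i * e)%:Z - (j * e)%:Z)).
  have -> : l%:R ^ (z * d%:Z + (i * e)%:Z - (j * e)%:Z) =
      (((x / y) ^+ e / l%:R ^ z) ^+ d)^-1 * ((x * th ^+ i) / (y * th ^+ j)) ^+ (e * d) :> algC.
    rewrite !expfzDr // -invr_expz -!exprnP -exprz_exp -exprnP.
    rewrite !exprMn !exprVn !exprMn !radical_exp -!exprM.
    have lz : (l%:R ^ z : algC) != 0 by rewrite expfz_neq0.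
    by field; rewrite !expf_neq0 // y0.
  by apply: (vunitM Aval); [apply/vunitV|]; apply: (vunitX Aval).
have := vunit_lz Aval u3.
move=> h; have {h}h : (z * d%:Z = (j * e)%:Z - (i * e)%:Z) by lia.
have {h} : (d%:Z %| ((j%:Z - i%:Z) * e%:Z)%R)%Z.
  by apply/dvdzP; exists z; rewrite h mulrBl.
rewrite Gauss_dvdzl; last first.
  rewrite /coprimez /= ; apply/eqP; congr Posz; apply/eqP.
  by rewrite -/(coprime d e) prime_coprime // gtnNdvd // (leq_ltn_trans eD Dd).
move=> /dvdzP[w hw]; have : (w != 0)%R by apply: contra_neq ij => w0; move: hw; rewrite w0; lia.
move: hw id jd; move: i j {ij u2 u3} => i j hw id jd w0.
have : (1 <= `|w|)%N by rewrite absz_gt0.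
nia.
Qed.

(** [th] has valuation 1/d, so a denominator e of v(x) becomes e d. *)
Lemma vexp_term x i : vexp l A D x -> vexp l A (d * D) (x * th ^+ i).
Proof.
move=> [e [z [e0 eD u]]]; exists (e * d)%N, (z * d%:Z + (i * e)%:Z); split.
- by rewrite muln_gt0 e0 prime_gt0.
- by rewrite mulnC leq_mul2l eD orbT.
have -> : (x * th ^+ i) ^+ (e * d) / l%:R ^ (z * d%:Z + (i * e)%:Z) = (x ^+ e / l%:R ^ z) ^+ d.
  rewrite expfzDr // -!exprnP -exprz_exp -exprnP !exprMn radical_exp !exprVn exprM.
  have lz : (l%:R ^ z : algC) != 0 by rewrite expfz_neq0.
  by field; rewrite !expf_neq0.
exact: (vunitX Aval).
Qed.

Variable c : 'I_d -> algC.
Hypothesis vc : forall i, c i != 0 -> vexp l A D (c i).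
Hypothesis vcc : forall i j, c i != 0 -> c j != 0 -> vexp l A D (c i / c j).

Let t (i : 'I_d) := c i * th ^+ i.

Let t_neq0 i : t i != 0 -> c i != 0.
Proof. by rewrite /t mulf_eq0 => /norP[]. Qed.

Lemma terms_nonassoc i j : i != j -> t i != 0 -> t j != 0 -> ~ vunit A (t i / t j).
Proof.
move=> ij /t_neq0 i0 /t_neq0 j0; apply: kummer_nonassoc => //; exact: vcc.
Qed.

(** Valuation 0 is that of 1 times th^0, and [kummer_nonassoc] separates the indices i and 0. *)
Lemma term_nonunit (i : 'I_d) : (0 < i)%N -> ~ vunit A (t i).
Proof.
move=> i0 u; have c0 : c i != 0 by apply: t_neq0; case: u.
have := @kummer_nonassoc (c i) 1 i 0 c0 (oner_neq0 _).
rewrite divr1 mul1r expr0 divr1; apply => //; [exact: vc | exact: prime_gt0 | by rewrite -lt0n].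
Qed.

(** Unit factors keep the nonzero terms at distinct valuations, so they cannot cancel. With u = 1
    this yields the independence of the powers of [th]; with differences of roots of unity, the
    distinctness of conjugates. *)
Lemma kummer_sum_neq0 (u : 'I_d -> algC) k : c k != 0 -> u k != 0 ->
  (forall i, u i != 0 -> vunit A (u i)) ->
  \sum_(i < d) c i * th ^+ i * u i != 0.
Proof.
move=> ck uk uu; apply: (sum_neq0 Aval).
  by exists k; rewrite !mulf_neq0 ?expf_neq0 ?radical_neq0.
move=> i j ij; rewrite !mulf_eq0 => /norP[/norP[ci ti] ui] /norP[/norP[cj tj] uj].
have -> : c i * th ^+ i * u i / (c j * th ^+ j * u j) = (t i / t j) * (u i / u j).
  by rewrite /t; field; rewrite cj tj uj.
have uuij : vunit A (u i / u j) by apply: (vunitM Aval); [|apply: vunitV]; apply: uu.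
move=> /(vunitM Aval)/(_ (vunitV uuij)); rewrite mulfK; last by case: uuij.
by apply: terms_nonassoc => //; rewrite mulf_neq0.
Qed.

(** The two sums have the same terms up to roots of unity. The bound v(vdist) >= 1/(dD) comes from
    the terms of positive index if all terms are integral, and from the pole of the dominant term
    otherwise. *)
Lemma kummer_pair eta : (0 < D)%N -> eta ^+ d = 1 ->
  A (vdist A (\sum_(i < d) c i * th ^+ i)
      (\sum_(i < d) c i * th ^+ i * eta ^+ i) ^+ (d * D) / l%:R).
Proof.
move=> D0 etad; set a := \sum_(i < d) _; set b := \sum_(i < d) _.
have dD0 : (0 < d * D)%N by rewrite muln_gt0 prime_gt0.
have u1 := vunit_root1 Aval (prime_gt0 dpr) etad.
have ue i : vunit A (eta ^+ i) by apply: (vunitX Aval).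
have Ae i : A (1 - eta ^+ i) by apply: (subringB Asub); [apply: subring1 Asub | case: (ue i)].
have ab : a - b = \sum_(i < d) t i * (1 - eta ^+ i).
  by rewrite /a /b -sumrB; apply: eq_bigr => i _; rewrite /t; ring.
(* Without poles, the term of index 0 cancels in a - b, and every other nonzero term has positive
   valuation with denominator at most dD. *)
have [tA|] := pselect (forall i, A (t i)).
  have Aa : A a by apply: (subring_sum Asub) => i _; apply: tA.
  have Ab : A b by apply: (subring_sum Asub) => i _; apply: (subringM Asub) => //; [apply: tA | case: (ue i)].
  rewrite /vdist !vscale1 // !mulr1 ab; apply: (lpow_sum Aval) => // i _; first exact: (subringM Asub).
  have zero : A (0 ^+ (d * D) / l%:R).
    by rewrite expr0n gtn_eqF //= mul0r; apply: subring0 Asub.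
  have [i0|i0] := posnP i; first by rewrite i0 expr0 subrr mulr0.
  rewrite exprMn mulrAC; apply: (subringM Asub); last exact: (subringX Asub).
  have [t0|t0] := eqVneq (t i) 0.
    by rewrite t0.
  apply: (vmax_pow lpr Aval); first by split=> //; apply: term_nonunit.
  by apply/vexp_term/vc/t_neq0.
(* With a pole, a and b both have the valuation of the dominant term t_k, so (a - b)/(a b) is t_k^-1
   times an element of A, and v(t_k^-1) >= 1/(dD). *)
move=> /existsNP[i0 ni0].
have [|k k0 kmax] := dominant Aval _ terms_nonassoc.
  by exists i0; apply: contra_notN ni0 => /eqP ->; apply: subring0 Asub.
have nAk : ~ A (t k).
  move=> Ak; apply: ni0; have [->//|ik] := eqVneq i0 k.
  by rewrite -[t i0](divfK k0); apply: (subringM Asub) => //; case: (kmax _ ik).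
have ua : vunit A (a / t k).
  have := dominant_sum Aval k0 kmax (fun=> vunit1 Aval).
  by under eq_bigr do rewrite mulr1.
have ub : vunit A (b / t k) by apply: (dominant_sum Aval k0 kmax) => i.
have nA x : vunit A (x / t k) -> ~ A x.
  move=> [x0 _ Ai] Ax; apply: nAk; move: Ai; rewrite invf_div => Ai.
  have x00 : x != 0 by apply: contraNneq x0 => ->; rewrite mul0r.
  by rewrite -(divfK x00 (t k)); apply: (subringM Asub).
rewrite /vdist (vscaleV (nA _ ua)) (vscaleV (nA _ ub)).
have [a0 Aa Aa'] := ua; have [b0 Ab Ab'] := ub.
have a00 : a != 0 by apply: contraNneq a0 => ->; rewrite mul0r.
have b00 : b != 0 by apply: contraNneq b0 => ->; rewrite mul0r.
have -> : (a - b) / a / b = (a / t k - b / t k) * (a / t k)^-1 * (b / t k)^-1 * (t k)^-1.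
  by field; rewrite k0 a00 b00.
rewrite exprMn -[X in A X]mulrA; apply: (subringM Asub).
  apply/(subringX Asub)/(subringM Asub) => //; apply/(subringM Asub) => //; exact: (subringB Asub).
apply: (vmax_pow lpr Aval).
  split; first by case: Aval => _ /(_ (t k))[].
  by move/vunitVE => [_ h _].
have := vexp_term k (vc (t_neq0 k0)); rewrite -/(t k) => -[e [z [e0 eD u]]].
exists e, (- z); split=> //.
have -> : (t k)^-1 ^+ e / l%:R ^ (- z) = (t k ^+ e / l%:R ^ z)^-1.
  have lz : (l%:R ^ z : algC) != 0 by rewrite expfz_neq0.
  by rewrite -invr_expz exprVn; field; rewrite lz expf_neq0.
exact: vunitV.
Qed.

(** If 1 - eta lay in the maximal ideal, so would each 1 - eta^i, and hence their sum over i < d.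
    That sum is d, because the powers of eta add up to 0, and d is a unit, being prime to l. *)
Lemma vunit_sub1 eta : coprime l d -> eta ^+ d = 1 -> eta != 1 -> vunit A (1 - eta).
Proof.
move=> co etad eta1; have [e0 Ae _] := vunit_root1 Aval (prime_gt0 dpr) etad.
apply: contrapT => nu.
have mx : vmax A (1 - eta) by split=> //; apply: (subringB Asub) => //; apply: subring1 Asub.
have s0 : \sum_(i < d) eta ^+ i = 0.
  apply/eqP; have := subrX1 eta d; rewrite etad subrr => /esym/eqP.
  by rewrite mulf_eq0 subr_eq0 (negPf eta1).
have : vmax A (\sum_(i < d) (1 - eta ^+ i)).
  apply: (vmax_sum Aval) => i _; rewrite -opprB subrX1 -mulNr opprB mulrC.
  apply: (vmaxM Aval) => //; apply: (subring_sum Asub) => j _; exact: (subringX Asub).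
rewrite sumrB s0 subr0 sumr_const card_ord => -[_]; apply.
exact: (vunit_nat lpr Aval).
Qed.

Lemma root1_coprime (w : algC) k : (0 < k < d)%N -> w ^+ d = 1 -> w ^+ k = 1 -> w = 1.
Proof.
move=> /andP[k0 kd] wd wk; have [a _] := Bezoutl d k0.
have -> : gcdn k d = 1%N by rewrite gcdnC; apply/eqP; rewrite -/(coprime d k) prime_coprime // gtnNdvd.
move=> /dvdnP[b eb]; have : w ^+ (1 + a * d) = 1 by rewrite eb mulnC exprM wk expr1n.
by rewrite exprD expr1 mulnC exprM wd expr1n mulr1.
Qed.

(** In the difference of the sums, the factors eta^i - nu^i are zero or units by [vunit_sub1], and
    the k-th is nonzero because d is prime and 0 < k < d. *)
Lemma kummer_conj_neq eta nu (k : 'I_d) : coprime l d -> eta ^+ d = 1 -> nu ^+ d = 1 -> eta != nu ->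
  (0 < k)%N -> c k != 0 ->
  \sum_(i < d) c i * th ^+ i * eta ^+ i != \sum_(i < d) c i * th ^+ i * nu ^+ i.
Proof.
move=> co etad nud en k0 ck; rewrite -subr_eq0 -sumrB.
under eq_bigr do rewrite -mulrBr.
have [e0 _ _] := vunit_root1 Aval (prime_gt0 dpr) etad.
pose w := nu / eta; have wd : w ^+ d = 1 by rewrite exprMn exprVn etad nud divr1.
have we i : eta ^+ i - nu ^+ i = eta ^+ i * (1 - w ^+ i).
  by rewrite mulrBr mulr1 -exprMn mulrCA divff // mulr1.
apply: (kummer_sum_neq0 ck).
  rewrite we mulf_neq0 ?expf_neq0 // subr_eq0 eq_sym.
  apply: contra_neq en => wk; have w1 : w = 1 by apply: (@root1_coprime w k) => //; rewrite k0 ltn_ord.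
  by apply/esym/(divIf e0); rewrite divff.
move=> i; rewrite we => h; apply: (vunitM Aval); first exact/(vunitX Aval)/(vunit_root1 Aval (prime_gt0 dpr)).
apply: vunit_sub1 => //; first by rewrite exprAC wd expr1n.
by apply: contra_neq h => ->; rewrite subrr mulr0.
Qed.

End Kummer.

(** * Automorphisms of algC and rationality *)

(** In a number field generated by the roots of [minCpoly x], sending x to y extends to the whole
    splitting field, and the map obtained there extends to [algC]. *)
Lemma algC_conj_aut (x y : algC) : root (minCpoly x) y ->
  exists nu : {rmorphism algC -> algC}, nu x = y.
Proof.
have [q [Dq qmon] qP] := minCpolyP x; rewrite Dq => qy.
have [s Ds] := closed_field_poly_normal (map_poly ratr q : {poly algC}).
have q0 : q != 0 by apply: monic_neq0.
have mem_s z : (z \in s) = root (map_poly ratr q) z.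
  by rewrite Ds rootZ ?root_prod_XsubC // lead_coef_eq0 map_poly_eq0.
have [Qs [QC [s1 Ds1 gens1]]] := num_field_exists s.
have [x1 x1s Dx] : exists2 x1, x1 \in s1 & QC x1 = x.
  have : x \in s by rewrite mem_s qP.
  by rewrite -Ds1 => /mapP[x1 x1s ->]; exists x1.
have [y1 y1s Dy] : exists2 y1, y1 \in s1 & QC y1 = y.
  have : y \in s by rewrite mem_s.
  by rewrite -Ds1 => /mapP[y1 y1s ->]; exists y1.
pose p : {poly Qs} := map_poly (in_alg Qs) q.
have mapp : map_poly QC p = map_poly ratr q.
  rewrite -map_poly_comp; apply: eq_map_poly => a.
  by rewrite /= alg_num_field fmorph_rat.
have Fp : p \is a polyOver 1%VS.
  by apply/polyOverP => i; rewrite coef_map /= rpredZ // mem1v.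
have splitp (K : {subfield Qs}) : splittingFieldFor K p {:Qs}.
  exists s1.
    rewrite -(eqp_map QC) mapp.
    have -> : map_poly QC (\prod_(z <- s1) ('X - z%:P)) = \prod_(z <- s) ('X - z%:P).
      rewrite rmorph_prod -Ds1 big_map; apply: eq_bigr => z _.
      by rewrite rmorphB /= map_polyX map_polyC.
    by rewrite {1}Ds -Dq (monicP (minCpoly_monic x)) scale1r eqpxx.
  by apply/eqP; rewrite eqEsubv subvf -gens1 adjoin_seqSl // sub1v.
have hom1 : kHom 1 1 (\1%VF : 'End(Qs)) by rewrite kHom1.
have ry : root (map_poly \1%VF (minPoly 1 x1)) y1.
  rewrite (@eq_map_poly _ _ _ idfun) => [|a]; last by rewrite /= id_lfunE.
  rewrite map_poly_id //.
  (* The minimal polynomial over the prime subfield has rational coefficients and vanishes at x, so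
     [minCpoly x] divides it and y is a root too. *)
  have aP i : (minPoly 1 x1)`_i \in 1%VS by apply/polyOverP/minPolyOver.
  pose m := \poly_(i < size (minPoly 1 x1)) sval (sig_eqW (vlineP _ _ (aP i))).
  have Dm : minPoly 1 x1 = map_poly (in_alg Qs) m.
    apply/polyP => i; rewrite coef_map coef_poly /=; case: ltnP => h.
      by case: (sig_eqW _) => a /= ->.
    by rewrite nth_default // scale0r.
  have mapm : map_poly QC (minPoly 1 x1) = map_poly ratr m.
    rewrite Dm -map_poly_comp; apply: eq_map_poly => a.
    by rewrite /= alg_num_field fmorph_rat.
  have : root (map_poly ratr m) x by rewrite -mapm -Dx fmorph_root root_minPoly.
  rewrite qP => /dvdpP[r Dr].
  by rewrite -(fmorph_root QC) mapm Dr rmorphM rootM /= -Dy in qy *; rewrite qy orbT.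
have homf := kHomExtendP (sub1v _) hom1 ry.
have [f homLf fx] := kHom_extends (sub1v _) homf Fp (splitp _).
have phim := kHom_monoid_morphism homLf.
pose phimM := GRing.isMonoidMorphism.Build _ _ f phim.
pose phiRM : {rmorphism _ -> _} := HB.pack (fun_of_lfun f) phimM.
have [nu Dnu] := extend_algC_subfield_aut QC phiRM.
exists nu; rewrite -Dx -Dnu /= -Dy; congr (QC _).
rewrite -fx ?memv_adjoin //.
by rewrite (kHomExtend_val hom1).
Qed.

Lemma minCpoly_conj (x y : algC) : root (minCpoly x) y -> minCpoly y = minCpoly x.
Proof. by move=> /algC_conj_aut[nu <-]; apply: minCpoly_aut. Qed.

(** A common root with the derivative is a conjugate of x, so it has the same minimal polynomial,
    which would divide its own nonzero derivative of smaller degree. *)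
Lemma separable_minCpoly (x : algC) : separable_poly (minCpoly x).
Proof.
rewrite separable_poly.unlock.
apply/Pdiv.ClosedField.coprimepP => y py.
apply/negP => dy; have [q [Dq qmon] qP] := minCpolyP y.
have {}dy : root (map_poly ratr q^`()) y by rewrite -deriv_map -Dq (minCpoly_conj py).
have sq : (1 < size q)%N.
  by have := size_minCpoly y; rewrite Dq size_map_poly.
have q0 : q != 0 by rewrite -size_poly_gt0; lia.
have q'0 : q^`() != 0.
  apply/eqP => /(congr1 (fun r : {poly rat} => r`_(size q).-2)).
  rewrite coef_deriv coef0 => /eqP; rewrite mulrn_eq0 /=.
  have -> : ((size q).-2.+1 = (size q).-1)%N by lia.
  by rewrite -lead_coefE lead_coef_eq0 (negPf q0).
rewrite qP in dy; have := dvdp_leq q'0 dy.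
by rewrite leqNgt lt_size_deriv.
Qed.

(** The roots of [minCpoly x] are images of x under such maps, hence all equal to x; by separability
    the polynomial is X - x. *)
Lemma fixed_rational (x : algC) :
  (forall nu : {rmorphism algC -> algC}, nu x = x) -> x \in Crat.
Proof.
move=> fx; have [q [Dq qmon] qP] := minCpolyP x.
have [s Ds] := closed_field_poly_normal (minCpoly x).
rewrite (monicP (minCpoly_monic x)) scale1r in Ds.
have sx z : z \in s -> z = x.
  by rewrite -root_prod_XsubC -Ds => /algC_conj_aut[nu <-].
have us : uniq s by rewrite -separable_prod_XsubC -Ds separable_minCpoly.
have s1 : s = [:: x].
  case: s us sx Ds => [|z [|w s]] us sx Ds.
  - by have := root_minCpoly x; rewrite Ds big_nil (negPf (root1 _)).
  - by rewrite (sx z) ?mem_head.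
  - by move: us; rewrite /= (sx z) ?mem_head // (sx w) ?inE ?eqxx ?orbT.
have : (minCpoly x)`_0 = - x.
  by rewrite Ds s1 big_seq1 coefB coefX coefC sub0r.
rewrite Dq coef_map /= => h; apply/CratP; exists (- q`_0).
by rewrite rmorphN /= h opprK.
Qed.

(** * The discriminant *)

Lemma max1_ge1 (z : algC) : 1 <= Num.max 1 `|z|.
Proof. by rewrite /Num.max; case: ifP => // /ltW. Qed.

Lemma max1_ge (z : algC) : `|z| <= Num.max 1 `|z|.
Proof.
rewrite /Num.max; case: ifP => // h.
by rewrite real_leNgt ?h ?realE ?ler01 ?normr_ge0.
Qed.

Lemma max1_ge0 (z : algC) : 0 <= Num.max 1 `|z|.
Proof. exact: le_trans ler01 (max1_ge1 z). Qed.

(** For a duplicate-free [s], this is up to sign the discriminant of the polynomial with leading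
    coefficient [a] and roots [s]. *)
Definition pair_disc (a : algC) (s : seq algC) : algC :=
  a ^+ (2 * (size s).-1) * \prod_(x <- s) \prod_(y <- s | y != x) (x - y).

Section PairProducts.
Variable s : seq algC.
Hypothesis us : uniq s.

Lemma prod_pairs_l (g : algC -> algC) :
  \prod_(x <- s) \prod_(y <- s | y != x) g x = \prod_(x <- s) g x ^+ (size s).-1.
Proof.
rewrite !big_seq; apply: eq_bigr => x xs; rewrite big_const_seq -/(iterop _ _ _ _).
rewrite iter_mulr mulr1; congr (_ ^+ _).
have := count_predC (pred1 x) s; rewrite -/(count_mem x s) count_uniq_mem // xs.
by move=> <-; rewrite add1n.
Qed.

Lemma prod_pairs_r (g : algC -> algC) :
  \prod_(x <- s) \prod_(y <- s | y != x) g y = \prod_(x <- s) g x ^+ (size s).-1.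
Proof.
rewrite (exchange_big_dep xpredT) //= -prod_pairs_l; apply: eq_bigr => y _.
by apply: eq_bigl => x; rewrite eq_sym.
Qed.

Lemma pair_disc_norm_le (a : algC) :
  `|pair_disc a s| <=
    ((size s)`!)%:R ^+ 2 * (`|a| * \prod_(z <- s) Num.max 1 `|z|) ^+ (2 * (size s).-1).
Proof.
set n := size s; pose V := Vandermonde n (\row_(i < n) s`_i).
(* Leibniz expansion: each of the n! products takes one power of every s_i, with exponent at most n
   - 1. *)
have detV : `|\det V| <= (n`!)%:R * \prod_(z <- s) Num.max 1 `|z| ^+ n.-1.
  apply: le_trans (ler_norm_sum _ _ _) _.
  rewrite -(card_Sn n) mulr_natl -sumr_const; apply: ler_sum => p _.
  rewrite normrM normrX normrN1 expr1n mul1r normr_prod.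
  rewrite (big_nth 0) big_mkord -/n [leRHS](reindex_inj (@perm_inj _ p)) /=.
  apply: ler_prod => i _; rewrite !mxE normr_ge0 normrX /=.
  apply: le_trans (lerXn2r _ _ _ (max1_ge _)) _; rewrite ?nnegrE ?normr_ge0 ?max1_ge0 //.
  by apply: ler_weXn2l; [apply: max1_ge1 | have := ltn_ord i; lia].
(* Each unordered pair occurs twice, once in each order, whence the square of the Vandermonde
   determinant. *)
have prodE : `|\prod_(x <- s) \prod_(y <- s | y != x) (x - y)| = `|\det V| ^+ 2.
  rewrite det_Vandermonde !normr_prod.
  rewrite (big_nth 0) big_mkord -/n.
  have E i : (i < n)%N -> `|\prod_(y <- s | y != s`_i) (s`_i - y)| =
     (\prod_(j < n | (i < j)%N) `|s`_j - s`_i|) * (\prod_(j < n | (j < i)%N) `|s`_i - s`_j|).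
    move=> i_n; rewrite normr_prod (big_nth 0) big_mkord -/n.
    rewrite (bigID (fun j : 'I_n => (i < j)%N)) /=; congr (_ * _).
      apply: eq_big => [j|j _]; last by rewrite distrC.
      by rewrite nth_uniq //; lia.
    by apply: eq_bigl => j; rewrite nth_uniq //; lia.
  rewrite [LHS](eq_bigr _ (fun (i : 'I_n) _ => E i (ltn_ord i))).
  rewrite big_split /= expr2; congr (_ * _).
    by apply: eq_bigr => i _; rewrite normr_prod; apply: eq_bigr => j _; rewrite !mxE.
  rewrite (exchange_big_dep xpredT) //=.
  by apply: eq_bigr => i _; rewrite normr_prod; apply: eq_bigr => j _; rewrite !mxE.
rewrite /pair_disc -/n normrM prodE normrX exprMn [leRHS]mulrCA.
apply: ler_wpM2l; first by rewrite exprn_ge0.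
apply: le_trans (lerXn2r 2 _ _ detV) _; rewrite ?nnegrE ?normr_ge0 //.
  by apply: le_trans detV; apply: normr_ge0.
by rewrite exprMn prodrXl -exprM mulnC.
Qed.

Lemma pair_disc_fixed (a : algC) (nu : {rmorphism algC -> algC}) :
  nu a = a -> {in s, forall z, nu z \in s} -> nu (pair_disc a s) = pair_disc a s.
Proof.
move=> nua nus; rewrite /pair_disc rmorphM rmorphXn nua; congr (_ * _).
have pe : perm_eq [seq nu z | z <- s] s.
  apply: uniq_perm => //; first by rewrite map_inj_uniq //; apply: fmorph_inj.
  apply: (uniq_min_size _ _ _).2; rewrite ?size_map ?map_inj_uniq //; first exact: fmorph_inj.
  by move=> _ /mapP[z zs ->]; apply: nus.
rewrite rmorph_prod -[RHS](perm_big _ pe) big_map; apply: eq_bigr => x _.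
rewrite rmorph_prod -[RHS](perm_big _ pe) big_map; apply: eq_big => y; rewrite ?rmorphB //.
by rewrite (inj_eq (fmorph_inj nu)).
Qed.

(** Each element of s occurs in 2(n - 1) differences, so its scaling can be moved to the leading
    coefficient. For the roots of an integer polynomial the first factor is then integral by
    [gauss_roots], the second by [vdist_in]. *)
Lemma pair_disc_vdist A (a : algC) : (forall z, vscale A z != 0) ->
  pair_disc a s = (a * \prod_(z <- s) (vscale A z)^-1) ^+ (2 * (size s).-1) *
     \prod_(x <- s) \prod_(y <- s | y != x) vdist A x y.
Proof.
move=> sc0; rewrite /pair_disc exprMn -mulrA; congr (_ * _).
have -> : \prod_(x <- s) \prod_(y <- s | y != x) vdist A x y =
   \prod_(x <- s) \prod_(y <- s | y != x) (x - y) *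
   ((\prod_(z <- s) vscale A z) ^+ (2 * (size s).-1)).
  rewrite mul2n -addnn exprD -!prodrXl -{1}prod_pairs_l -prod_pairs_r -!big_split /=.
  apply: eq_bigr => x _; rewrite -!big_split /=; apply: eq_bigr => y _.
  by rewrite /vdist; ring.
rewrite mulrCA -exprMn -big_split /=.
have -> : \prod_(z <- s) ((vscale A z)^-1 * vscale A z) = 1.
  by apply: big1_seq => z _; rewrite mulVf.
by rewrite expr1n mulr1.
Qed.

End PairProducts.

Section LPower.
Variables (l : nat) (A : set algC).
Hypotheses (lpr : prime l) (Aval : valring l A).

Let Asub : subring_at l A. Proof. by case: Aval. Qed.

Lemma prod_lpow (I : Type) (s : seq I) (P : pred I) (F : I -> algC) r :
  (forall i, A (F i)) ->
  (r <= count (fun i => P i && `[< A (F i / l%:R) >]) s)%N ->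
  A (\prod_(i <- s | P i) F i / l%:R ^+ r).
Proof.
move=> AF; elim: s r => [|i s IH] r /=.
  by rewrite leqn0 => /eqP ->; rewrite big_nil divr1; apply: subring1 Asub.
rewrite big_cons; case: (P i) => //=; last by rewrite add0n; apply: IH.
case: asboolP => [Ai|_] /=; last first.
  by rewrite add0n => /IH h; rewrite -mulrA; apply: (subringM Asub).
case: r => [_|r]; last first.
  rewrite add1n ltnS => /IH h; rewrite exprS invfM mulrACA.
  exact: (subringM Asub).
rewrite expr0 divr1; apply: (subringM Asub) => //; apply: (subring_prod Asub) => j _; exact: AF.
Qed.

End LPower.

(** The N-th power of the discriminant divided by p^(n r), with n the number of roots, is rational
    and lies in every valuation ring. By [rat_integral] it is a nonzero integer, so its absolute
    value is at least 1; [pair_disc_norm_le] bounds it from above. *)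
Lemma disc_bound (f : {poly int}) (s : seq algC) (p N r : nat) :
  f != 0 -> uniq s -> map_poly intr f = (lead_coef f)%:~R *: \prod_(z <- s) ('X - z%:P) ->
  prime p ->
  (forall A, valring p A -> forall x, x \in s ->
     (r <= count (fun y => (y != x) && `[< A (vdist A x y ^+ N / p%:R) >]) s)%N) ->
  (p%:R : algC) ^+ (size s * r) <=
    (((size s)`!)%:R ^+ 2 * (`|(lead_coef f)%:~R| * \prod_(z <- s) Num.max 1 `|z|)
        ^+ (2 * (size s).-1)) ^+ N.
Proof.
move=> f0 us Df ppr good; set a : algC := (lead_coef f)%:~R in Df *.
have p0 : (0 : algC) < p%:R by rewrite ltr0n prime_gt0.
have a0 : a != 0 by rewrite intr_eq0 lead_coef_eq0.
have rootf (z : algC) : (z \in s) = root (map_poly intr f) z.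
  by rewrite Df rootZ ?root_prod_XsubC.
have dQ : pair_disc a s \in Crat.
  apply: fixed_rational => nu; apply: pair_disc_fixed => //; first by rewrite /a rmorph_int.
  move=> z; rewrite !rootf => rz.
  have -> : map_poly intr f = map_poly nu (map_poly intr f) :> {poly algC}.
    by rewrite -map_poly_comp; apply: eq_map_poly => c; rewrite /= rmorph_int.
  by rewrite fmorph_root.
set q := pair_disc a s ^+ N / p%:R ^+ (size s * r).
have Aq l A : prime l -> valring l A -> A q.
  move=> lpr Aval; have Asub : subring_at l A by case: Aval.
  have AG : A (a * \prod_(z <- s) (vscale A z)^-1).
    by apply: (gauss_roots Aval) => i; rewrite -Df coef_map; apply: subring_int Asub _.
  rewrite /q (pair_disc_vdist us a (vscale_neq0 Aval)).
  rewrite [(_ * _) ^+ N]exprMn -[X in A X]mulrA.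
  apply: (subringM Asub); first by do 2!apply: (subringX Asub).
  (* Away from p the division is by a unit; above p each root supplies r factors p through its close
     partners. *)
  have [pl|pl] := eqVneq l p; last first.
    apply: (subringM Asub).
      apply: (subringX Asub); do 2!apply: (subring_prod Asub) => ? _; exact: (vdist_in Aval).
    have [|_ _] := @vunitX l A Aval p%:R (size s * r); last by [].
    by apply: (vunit_nat lpr Aval); rewrite prime_coprime // dvdn_prime2.
  subst l; rewrite mulnC exprM -prodrXl.
  have -> : p%:R ^+ r ^+ size s = \prod_(x <- s) p%:R ^+ r :> algC.
    by rewrite big_const_seq count_predT iter_mulr mulr1.
  rewrite -prodf_div big_seq; apply: (subring_prod Asub) => x xs.
  rewrite -prodrXl; apply: (prod_lpow Aval).
    by move=> y; apply/(subringX Asub)/(vdist_in Aval).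
  exact: good.
have qQ : q \in Crat by rewrite /q rpred_div ?rpredX // ?rpred_nat.
have /norm_intr_ge1 : q \is a Num.int by apply: rat_integral.
have d0 : pair_disc a s != 0.
  rewrite mulf_neq0 ?expf_neq0 // prodf_seq_neq0; apply/allP => x _ /=.
  rewrite prodf_seq_neq0; apply/allP => y _ /=; apply/implyP.
  by rewrite subr_eq0 eq_sym.
rewrite mulf_neq0 ?invr_eq0 ?expf_neq0 ?(gt_eqF p0) // => /(_ isT).
rewrite normrM normfV !normrX (ger0_norm (ltW p0)) ler_pdivlMr ?exprn_gt0 // mul1r.
move/le_trans; apply; apply: lerXn2r; rewrite ?nnegrE ?normr_ge0 //.
  by apply: le_trans (pair_disc_norm_le us a); apply: normr_ge0.
exact: pair_disc_norm_le.
Qed.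

(** * Subfields of algC spanned by finitely many elements *)

Definition qring (K : set algC) : Prop :=
  [/\ forall q : rat, K (ratr q), forall x y, K x -> K y -> K (x - y)
    & forall x y, K x -> K y -> K (x * y)].

(** A form of [K : Q] <= D that avoids bases and vector space structures. *)
Definition qspan (D : nat) (K : set algC) : Prop :=
  exists (I : finType) (b : I -> algC), #|I| = D /\
    forall x, K x -> exists q : I -> rat, x = \sum_i ratr (q i) * b i.

(* The coefficients do not depend on the d-th root t of m, so a relation found at
   one root passes to its conjugates. *)
Definition Kfun (K : set algC) (d : nat) (m : algC) (h : algC -> algC) : Prop :=
  exists c : nat -> algC, (forall i, K (c i)) /\
    forall t, t ^+ d = m -> h t = \sum_(i < d) c i * t ^+ i.

Definition adjoin_root (K : set algC) (d : nat) (th : algC) : set algC :=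
  [set x | exists c : nat -> algC, (forall i, K (c i)) /\ x = \sum_(i < d) c i * th ^+ i].

Section QRing.
Variable K : set algC.
Hypothesis Kq : qring K.

Lemma qring_rat q : K (ratr q). Proof. by case: Kq. Qed.
Lemma qring0 : K 0. Proof. by rewrite -(rmorph0 (ratr : {rmorphism rat -> algC})); apply: qring_rat. Qed.
Lemma qring1 : K 1. Proof. by rewrite -(rmorph1 (ratr : {rmorphism rat -> algC})); apply: qring_rat. Qed.
Lemma qring_nat n : K n%:R.
Proof. by rewrite -(rmorph_nat (ratr : {rmorphism rat -> algC})); apply: qring_rat. Qed.
Lemma qringB x y : K x -> K y -> K (x - y). Proof. by case: Kq => _ + _; apply. Qed.
Lemma qringM x y : K x -> K y -> K (x * y). Proof. by case: Kq => _ _; apply. Qed.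
Lemma qringN x : K x -> K (- x). Proof. by rewrite -sub0r; apply: qringB; apply: qring0. Qed.
Lemma qringD x y : K x -> K y -> K (x + y).
Proof. by move=> Kx Ky; rewrite -[y]opprK; apply: qringB => //; apply: qringN. Qed.
Lemma qringX x n : K x -> K (x ^+ n).
Proof. by move=> Kx; elim: n => [|n IH]; [rewrite expr0; apply: qring1 | rewrite exprS; apply: qringM]. Qed.

(** x is algebraic: a polynomial relation, divided by X until its constant term is nonzero,
    expresses x^-1 as a polynomial in x. *)
Lemma qringV x : K x -> K x^-1.
Proof.
move=> Kx; have [->|x0] := eqVneq x 0; first by rewrite invr0; apply: qring0.
have [q [Dq qmon] qP] := minCpolyP x.
have : root (map_poly ratr q) x by rewrite qP.
have qn0 : q != 0 by apply: monic_neq0.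
move: qn0; rewrite /root; move: q {Dq qmon qP}.
have Kh (r : {poly rat}) : K (map_poly ratr r).[x].
  elim/poly_ind: r => [|r c IH]; first by rewrite rmorph0 horner0; apply: qring0.
  rewrite rmorphD rmorphM /= map_polyX map_polyC hornerMXaddC.
  by apply: qringD; [apply: qringM | apply: qring_rat].
elim/poly_ind => [|r c IH]; first by rewrite eqxx.
move=> rc0; rewrite rmorphD rmorphM /= map_polyX map_polyC hornerMXaddC => /eqP rt.
have [c0|c0] := eqVneq c 0.
  apply: IH; first by apply: contraNneq rc0 => ->; rewrite c0 mul0r addr0.
  by move/eqP: rt; rewrite c0 raddf0 addr0 mulf_eq0 (negPf x0) orbF.
have cc0 : (ratr c : algC) != 0 by rewrite fmorph_eq0.
have -> : x^-1 = - ((map_poly ratr r).[x] * ratr c^-1).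
  rewrite fmorphV; apply: (mulfI x0); rewrite divff //.
  have -> : (map_poly ratr r).[x] = - ratr c / x.
    by apply: (mulIf x0); rewrite divfK //; apply/eqP; rewrite -subr_eq0 opprK rt.
  by field; rewrite x0 cc0.
by apply/qringN/qringM => //; apply: qring_rat.
Qed.

(** The D + 1 powers 1, x, ..., x^D have D coordinates each, so their coordinate matrix has a
    nonzero left kernel vector. *)
Lemma qspan_alg D x : qspan D K -> K x ->
  exists q : {poly rat}, [/\ q != 0, (size q <= D.+1)%N & root (map_poly ratr q) x].
Proof.
move=> [I [b [cI span]]] Kx.
have /choice[m Dm] (i : 'I_D.+1) := span _ (qringX i Kx).
pose M := \matrix_(i < D.+1, j < #|I|) m i (enum_val j).
have kM : kermx M != 0.
  rewrite -mxrank_eq0 mxrank_ker subn_eq0 -ltnNge.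
  by apply: leq_ltn_trans (rank_leq_col _) _; rewrite cI.
have /rowV0Pn[v vk v0] := kM.
have vM : v *m M = 0 by apply/sub_kermxP.
exists (rVpoly v); split.
- by apply: contra_neq v0 => h; apply: (can_inj (@rVpolyK _ _)); rewrite h linear0.
- exact: size_poly.
rewrite /root (@horner_coef_wide _ D.+1); last by rewrite size_map_poly; apply: size_poly.
have -> : \sum_(i < D.+1) (map_poly ratr (rVpoly v))`_i * x ^+ i =
    \sum_(k < #|I|) ratr ((v *m M) 0 k) * b (enum_val k) :> algC.
  transitivity (\sum_(i < D.+1) \sum_(k < #|I|) ratr (v 0 i * M i k) * b (enum_val k) : algC).
    apply: eq_bigr => i _; rewrite coef_map /= coef_rVpoly_ord Dm mulr_sumr.
    rewrite (reindex _ (onW_bij _ (enum_val_bij I))) /=; apply: eq_bigr => k _.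
    by rewrite mxE rmorphM /= mulrA.
  rewrite exchange_big; apply: eq_bigr => k _ /=.
  by rewrite mxE rmorph_sum mulr_suml.
by rewrite vM big1 // => k _; rewrite mxE rmorph0 mul0r.
Qed.

Section Kfun.
Variables (d : nat) (m : algC).
Hypotheses (d0 : (0 < d)%N) (Km : K m).

Lemma Kfun_const x : K x -> Kfun K d m (fun=> x).
Proof.
move=> Kx; exists (fun i => if i == 0%N then x else 0); split.
  by move=> i; case: ifP => _ //; apply: qring0.
move=> t _; case: d d0 => // n _; rewrite big_ord_recl /= expr0 mulr1 big1 ?addr0 // => i _.
by rewrite mul0r.
Qed.

Lemma Kfun_add h g : Kfun K d m h -> Kfun K d m g -> Kfun K d m (fun t => h t + g t).
Proof.
move=> [c [Kc hc]] [e [Ke he]]; exists (fun i => c i + e i); split; first by move=> i; apply: qringD.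
by move=> t td; rewrite hc // he // -big_split; apply: eq_bigr => i _; rewrite mulrDl.
Qed.

Lemma Kfun_scale x h : K x -> Kfun K d m h -> Kfun K d m (fun t => x * h t).
Proof.
move=> Kx [c [Kc hc]]; exists (fun i => x * c i); split; first by move=> i; apply: qringM.
by move=> t td; rewrite hc // mulr_sumr; apply: eq_bigr => i _; rewrite mulrA.
Qed.

Lemma Kfun_mulX h : Kfun K d m h -> Kfun K d m (fun t => t * h t).
Proof.
case: d d0 => // n _ [c [Kc hc]].
(* With d = n + 1, the top term c_n t^n becomes c_n t^d = m c_n and wraps round to the constant
   coefficient. *)
exists (fun i => if i is i'.+1 then c i' else m * c n); split.
  by case=> [|i] //; apply: qringM.
move=> t td; rewrite hc // big_ord_recr big_ord_recl /= expr0 mulr1 mulrDr addrC.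
congr (_ + _); first by rewrite mulrCA -exprS td mulrC.
by rewrite mulr_sumr; apply: eq_bigr => i _; rewrite /bump /= add1n exprS; ring.
Qed.

Lemma Kfun_mulXn n h : Kfun K d m h -> Kfun K d m (fun t => t ^+ n * h t).
Proof.
elim: n => [|n IH] Kh.
  by case: Kh => c [Kc hc]; exists c; split=> // t td; rewrite expr0 mul1r hc.
have [c [Kc hc]] := Kfun_mulX (IH Kh); exists c; split=> // t td.
by rewrite -hc // exprS mulrA.
Qed.

Lemma Kfun_mul h g : Kfun K d m h -> Kfun K d m g -> Kfun K d m (fun t => h t * g t).
Proof.
move=> [c [Kc hc]] Kg.
suff H N : Kfun K d m (fun t => \sum_(i < N) c i * (t ^+ i * g t)).
  have [e [Ke he]] := H d; exists e; split=> // t td; rewrite -he // hc // mulr_suml.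
  by apply: eq_bigr => i _; rewrite mulrA.
elim: N => [|n IH].
  have [e [Ke he]] := Kfun_const qring0; exists e; split=> // t td.
  by rewrite big_ord0 -he.
have [e [Ke he]] := Kfun_add IH (Kfun_scale (Kc n) (Kfun_mulXn n Kg)).
by exists e; split=> // t td; rewrite big_ord_recr -he.
Qed.

Lemma Kfun_horner (q : {poly rat}) h : Kfun K d m h ->
  Kfun K d m (fun t => (map_poly ratr q).[h t]).
Proof.
move=> Kh; elim/poly_ind: q => [|q c [e [Ke he]]].
  have [e [Ke he]] := Kfun_const qring0; exists e; split=> // t td.
  by rewrite rmorph0 horner0 -he.
have [e' [Ke' he']] : Kfun K d m (fun t => (map_poly ratr q).[h t] * h t + ratr c).
  by apply: Kfun_add; [apply: Kfun_mul => //; exists e | apply/Kfun_const/qring_rat].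
exists e'; split=> // t td; rewrite -he' //.
by rewrite rmorphD rmorphM /= map_polyX map_polyC hornerMXaddC.
Qed.

Lemma adjoin_Kfun th x : th ^+ d = m -> adjoin_root K d th x ->
  exists2 h, Kfun K d m h & x = h th.
Proof.
move=> thd [c [Kc ->]]; exists (fun t => \sum_(i < d) c i * t ^+ i) => //.
by exists c; split.
Qed.

Lemma Kfun_adjoin th h : th ^+ d = m -> Kfun K d m h -> adjoin_root K d th (h th).
Proof. by move=> thd [c [Kc hc]]; exists c; split => //; apply: hc. Qed.

Lemma adjoin_root_base th x : K x -> adjoin_root K d th x.
Proof.
move=> Kx; exists (fun i => if i == 0%N then x else 0); split.
  by move=> i; case: ifP => _ //; apply: qring0.
case: d d0 => // n _; rewrite big_ord_recl /= expr0 mulr1 big1 ?addr0 // => i _.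
by rewrite mul0r.
Qed.

Lemma adjoin_root_gen th : th ^+ d = m -> adjoin_root K d th th.
Proof.
move=> thd; rewrite -[X in adjoin_root _ _ _ X]mulr1.
exact: (Kfun_adjoin thd (Kfun_mulX (Kfun_const qring1))).
Qed.

Lemma adjoin_root_qring th : th ^+ d = m -> qring (adjoin_root K d th).
Proof.
move=> thd; split.
- by move=> q; apply/adjoin_root_base/qring_rat.
- move=> _ _ /(adjoin_Kfun thd)[h Kh ->] /(adjoin_Kfun thd)[g Kg ->].
  rewrite -mulN1r; apply: (@Kfun_adjoin th (fun t => h t + -1 * g t)) => //.
  by apply/Kfun_add => //; apply/Kfun_scale => //; apply/qringN/qring1.
- move=> _ _ /(adjoin_Kfun thd)[h Kh ->] /(adjoin_Kfun thd)[g Kg ->].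
  exact: (@Kfun_adjoin th (fun t => h t * g t) thd (Kfun_mul Kh Kg)).
Qed.

Lemma adjoin_root_span D th : qspan D K -> qspan (d * D) (adjoin_root K d th).
Proof.
move=> [I [b [cI span]]]; exists ('I_d * I)%type, (fun u : 'I_d * I => b u.2 * th ^+ u.1); split.
  by rewrite card_prod card_ord cI.
move=> _ [c [Kc ->]]; have /choice[e he] i := span _ (Kc i).
exists (fun u : 'I_d * I => e u.1 u.2).
rewrite (eq_bigr (fun i : 'I_d => \sum_j ratr (e i j) * (b j * th ^+ i))).
  by rewrite pair_big.
by move=> i _; rewrite {1}he mulr_suml; apply: eq_bigr => j _; rewrite mulrA.
Qed.

End Kfun.
End QRing.

(** * Conjugates in a radical extension and their p-adic distances *)

Section Partners.
Variables (K : set algC) (D d p : nat) (th al : algC).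
Hypotheses (Kq : qring K) (Ksp : qspan D K) (D0 : (0 < D)%N).
Hypotheses (dpr : prime d) (ppr : prime p) (Dd : (D < d)%N) (pd : p != d).
Hypothesis thd : th ^+ d = p%:R.

Lemma vexp_K (nu : {rmorphism algC -> algC}) A x : valring p A -> K x -> x != 0 ->
  vexp p A D (nu x).
Proof.
move=> Aval Kx x0; have [q [q0 sq rq]] := qspan_alg Kq Ksp Kx.
apply: (vexp_alg ppr Aval _ q0 sq); first by rewrite fmorph_eq0.
have -> : map_poly ratr q = map_poly nu (map_poly ratr q) :> {poly algC}.
  by rewrite -map_poly_comp; apply: eq_map_poly => c; rewrite /= fmorph_rat.
by rewrite fmorph_root.
Qed.

(** In a valuation ring above p the nonzero terms have distinct valuations and cannot cancel. *)
Lemma kummer_free (c : nat -> algC) : (forall i, K (c i)) ->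
  \sum_(i < d) c i * th ^+ i = 0 -> forall i, (i < d)%N -> c i = 0.
Proof.
move=> Kc s0 i id; have [A Aval] := valring_exists (prime_gt1 ppr).
apply: contrapT => /eqP ci.
have vK x : K x -> x != 0 -> vexp p A D x by move=> Kx x0; apply: (vexp_K idfun Aval Kx x0).
have := @kummer_sum_neq0 p d D A th ppr dpr Dd Aval thd (fun i : 'I_d => c i) _
  (fun=> 1) (Ordinal id) ci (oner_neq0 _) (fun _ _ => vunit1 Aval).
under eq_bigr do rewrite mulr1; rewrite s0 eqxx => H.
suff : false by []; apply: H => j k cj ck.
by apply: vK; [apply: (qringM Kq) => //; apply: (qringV Kq) | rewrite mulf_neq0 ?invr_eq0].
Qed.

(** The minimal polynomial at sum c_i t^i equals sum e_i t^i with the same e_i for every d-th root t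
    of p. It vanishes at t = th, so all e_i are 0 by [kummer_free], and it vanishes at t = th
    eta. *)
Lemma kummer_conj (c : nat -> algC) eta : (forall i, K (c i)) -> eta ^+ d = 1 ->
  root (minCpoly (\sum_(i < d) c i * th ^+ i)) (\sum_(i < d) c i * th ^+ i * eta ^+ i).
Proof.
move=> Kc ed; have [q [Dq qmon] qP] := minCpolyP (\sum_(i < d) c i * th ^+ i).
have Kh : Kfun K d p%:R (fun t => \sum_(i < d) c i * t ^+ i) by exists c.
have [e [Ke he]] := Kfun_horner Kq (prime_gt0 dpr) (qring_nat Kq p) q Kh.
have e0 : forall i, (i < d)%N -> e i = 0.
  by apply: kummer_free Ke _; rewrite -he //; apply/eqP; rewrite -/(root _ _) -Dq root_minCpoly.
have -> : \sum_(i < d) c i * th ^+ i * eta ^+ i = \sum_(i < d) c i * (th * eta) ^+ i.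
  by apply: eq_bigr => i _; rewrite exprMn mulrA.
rewrite Dq /root he; last by rewrite exprMn ed mulr1.
by rewrite big1 // => i _; rewrite e0 // mul0r.
Qed.

(** An automorphism takes al to a. The expansion of a, twisted by the d - 1 nontrivial d-th roots of
    unity, gives the partners: close to a by [kummer_pair], distinct by [kummer_conj_neq]. *)
Lemma good_partners A a (s : seq algC) : adjoin_root K d th al -> ~ K al ->
  valring p A -> (forall z, (z \in s) = root (minCpoly al) z) -> a \in s ->
  (d.-1 <= count (fun y => (y != a) && `[< A (vdist A a y ^+ (d * D) / p%:R) >]) s)%N.
Proof.
move=> [c [Kc al_c]] nK Aval sE as_.
have [nu nua] := algC_conj_aut (etrans (esym (sE a)) as_).
(* Some coefficient of positive index is nonzero since al is not in K; it is what separates the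
   conjugates. *)
have [k ck] : exists k : 'I_d, (0 < k)%N && (c k != 0).
  apply: contrapT => H; apply: nK; rewrite al_c.
  rewrite (bigD1 (Ordinal (prime_gt0 dpr))) //= expr0 mulr1 big1 ?addr0 // => i i0.
  have [->|ci] := eqVneq (c i) 0; first by rewrite mul0r.
  by case: H; exists i; rewrite ci andbT lt0n.
have /andP[k0 ck0] := ck.
have [z zpr] := C_prim_root_exists (prime_gt0 dpr).
have zd i : (nu z ^+ i) ^+ d = 1.
  by rewrite exprAC -rmorphXn (prim_expr_order zpr) rmorph1 expr1n.
pose c' (i : 'I_d) := nu (c i); pose th' := nu th.
have th'd : th' ^+ d = p%:R by rewrite -rmorphXn thd rmorph_nat.
have vc i : c' i != 0 -> vexp p A D (c' i).
  by rewrite /c' fmorph_eq0; apply: vexp_K.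
have vcc i j : c' i != 0 -> c' j != 0 -> vexp p A D (c' i / c' j).
  rewrite /c' !fmorph_eq0 => ci cj; rewrite -fmorphV -rmorphM; apply: vexp_K => //.
    by apply: (qringM Kq) => //; apply: (qringV Kq).
  by rewrite mulf_neq0 ?invr_eq0.
pose B (j : 'I_d) := \sum_(i < d) c' i * th' ^+ i * (nu z ^+ j) ^+ i.
have Ba : a = \sum_(i < d) c' i * th' ^+ i.
  by rewrite -nua al_c rmorph_sum; apply: eq_bigr => i _; rewrite rmorphM rmorphXn.
have B0 j : nat_of_ord j = 0%N -> B j = a.
  by move=> j0; rewrite Ba; apply: eq_bigr => i _; rewrite j0 expr0 expr1n mulr1.
have co : coprime p d by rewrite prime_coprime // dvdn_prime2.
have Binj : injective B.
  move=> i j; apply: contra_eq => ij.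
  apply: (kummer_conj_neq ppr dpr Dd Aval th'd vcc co (zd _) (zd _) _ k0).
    rewrite -!rmorphXn (inj_eq (fmorph_inj nu)) (eq_prim_root_expr zpr).
    by rewrite !modn_small.
  by rewrite /c' fmorph_eq0.
have Bs j : B j \in s.
  rewrite sE; have -> : B j = nu (\sum_(i < d) c i * th ^+ i * (z ^+ j) ^+ i).
    by rewrite rmorph_sum; apply: eq_bigr => i _; rewrite !rmorphM !rmorphXn.
  rewrite -(minCpoly_aut nu al).
  have -> : minCpoly (nu al) = map_poly nu (minCpoly al).
    have [q [Dq _] _] := minCpolyP al; rewrite minCpoly_aut Dq -map_poly_comp.
    by apply: eq_map_poly => x; rewrite /= fmorph_rat.
  rewrite fmorph_root al_c; apply: kummer_conj => //.
  by rewrite exprAC (prim_expr_order zpr) expr1n.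
have d0 := prime_gt0 dpr; pose o0 := Ordinal d0.
(* The index 0 gives a itself and is left out. *)
pose L := [seq B j | j <- [seq j <- enum 'I_d | j != o0]].
have -> : d.-1 = size L.
  rewrite size_map size_filter; have := count_predC (pred1 o0) (enum 'I_d).
  rewrite -/(count_mem _ _) count_uniq_mem ?enum_uniq // mem_enum inE -cardE card_ord.
  by move=> h; apply: succn_inj; rewrite prednK //; apply: esym h.
rewrite -size_filter; apply: uniq_leq_size.
  by rewrite map_inj_uniq // filter_uniq // enum_uniq.
move=> y /mapP[j]; rewrite mem_filter => /andP[j0 _] ->; rewrite mem_filter Bs andbT.
rewrite -(B0 o0 erefl) (inj_eq Binj) j0; apply/asboolP.
by rewrite (B0 o0 erefl) Ba; apply: (kummer_pair ppr dpr Dd Aval th'd vc vcc D0 (zd j)).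
Qed.

End Partners.

(** * Lower bounds for the Mahler measure *)

Lemma min_zpolyE (a : algC) :
  map_poly intr (min_zpoly a) = (lead_coef (min_zpoly a))%:~R *: minCpoly a.
Proof.
rewrite /min_zpoly; case: (minCpolyP a) => q [Dq qmon] qP /=.
case: (rat_poly_scale q) => q' [c c0 Dq'] /=; set f := zprimitive q'.
have cE : (c%:~R : algC) != 0 by rewrite intr_eq0.
have Q : map_poly intr q' = c%:~R *: minCpoly a :> {poly algC}.
  rewrite Dq Dq' map_polyZ /=.
  have -> : ratr c%:~R^-1 = c%:~R^-1 :> algC by rewrite fmorphV /= ratr_int.
  rewrite scalerA divff // scale1r -map_poly_comp.
  by apply: eq_map_poly => x; rewrite /= ratr_int.
have k0 : (zcontents q')%:~R != 0 :> algC.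
  rewrite intr_eq0; apply/eqP => h; have := zpolyEprim q'; rewrite h scale0r => q'0.
  move: Dq'; rewrite q'0 rmorph0 scaler0 => q00.
  by move: qmon; rewrite q00 monicE lead_coef0 eq_sym oner_eq0.
have F : map_poly intr f = ((zcontents q')%:~R^-1 * c%:~R) *: minCpoly a.
  apply: (scalerI k0); rewrite scalerA mulrA divff // mul1r -Q {2}(zpolyEprim q').
  by rewrite map_polyZ.
rewrite F; congr (_ *: _).
have -> : (lead_coef f)%:~R = lead_coef (map_poly intr f) :> algC.
  by rewrite lead_coef_map_inj //; apply: intr_inj.
by rewrite F lead_coefZ (monicP (minCpoly_monic a)) mulr1.
Qed.

Lemma lead_min_zpoly (a : algC) : lead_coef (min_zpoly a) != 0.
Proof.
rewrite /min_zpoly; case: (minCpolyP a) => q [Dq qmon] qP /=.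
case: (rat_poly_scale q) => q' [c c0 Dq'] /=.
rewrite lead_coef_eq0 zprimitive_eq0; apply: contraTneq qmon => q'0.
by rewrite Dq' q'0 rmorph0 scaler0 monicE lead_coef0 eq_sym oner_eq0.
Qed.

Lemma croots_min_zpoly (a : algC) (s := croots (map_poly intr (min_zpoly a))) :
  minCpoly a = \prod_(z <- s) ('X - z%:P).
Proof.
rewrite /s /croots; case: closed_field_poly_normal => r /= Dr.
have L0 := lead_min_zpoly a; have L : (lead_coef (min_zpoly a))%:~R != 0 :> algC by rewrite intr_eq0.
have E : lead_coef (map_poly intr (min_zpoly a)) = (lead_coef (min_zpoly a))%:~R :> algC.
  by rewrite lead_coef_map_inj //; apply: intr_inj.
by apply: (scalerI L); rewrite -min_zpolyE {1}Dr E.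
Qed.

Lemma size_croots (a : algC) : size (croots (map_poly intr (min_zpoly a))) = alg_deg a.
Proof. by rewrite /alg_deg croots_min_zpoly size_prod_XsubC. Qed.

Lemma mem_croots (a z : algC) :
  (z \in croots (map_poly intr (min_zpoly a))) = root (minCpoly a) z.
Proof. by rewrite croots_min_zpoly root_prod_XsubC. Qed.

Lemma mahler_ge1 (a : algC) : 1 <= mahler_measure (min_zpoly a).
Proof.
rewrite /mahler_measure mulr_ege1 //.
  by apply: norm_intr_ge1; rewrite ?intr_int // intr_eq0 lead_min_zpoly.
by apply: (big_ind (fun x : algC => 1 <= x)) => // [x y|z _]; [apply: mulr_ege1 | apply: max1_ge1].
Qed.

Lemma alg_deg_gt0 (a : algC) : (0 < alg_deg a)%N.
Proof. by rewrite /alg_deg; have := size_minCpoly a; lia. Qed.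

Lemma alg_deg_le (a : algC) (q : {poly rat}) N : q != 0 -> (size q <= N.+1)%N ->
  root (map_poly ratr q) a -> (alg_deg a <= N)%N.
Proof.
move=> q0 sq; have [r [Dr _] rP] := minCpolyP a; rewrite rP => /(dvdp_leq q0) h.
by rewrite /alg_deg Dr size_map_poly -subn1 leq_subLR add1n; apply: leq_trans h sq.
Qed.

(** [disc_bound] with N = dD and the r = d - 1 partners of [good_partners]. *)
Lemma mahler_lower (K : set algC) (D d p : nat) (th al : algC) (n := alg_deg al) :
  qring K -> qspan D K -> (0 < D)%N -> prime d -> prime p -> (D < d)%N -> p != d ->
  th ^+ d = p%:R -> adjoin_root K d th al -> ~ K al ->
  (p%:R : algC) ^+ (n * d.-1) <=
    ((n`!)%:R ^+ 2 * mahler_measure (min_zpoly al) ^+ (2 * n.-1)) ^+ (d * D).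
Proof.
move=> Kq Ksp D0 dpr ppr Dd pd thd Kal nK.
set s := croots (map_poly intr (min_zpoly al)).
have -> : n = size s by rewrite size_croots.
apply: (disc_bound _ _ _ ppr); rewrite -?lead_coef_eq0 ?lead_min_zpoly //.
- by rewrite -separable_prod_XsubC -croots_min_zpoly separable_minCpoly.
- by rewrite -croots_min_zpoly min_zpolyE.
- move=> A Aval x xs; apply: (good_partners Kq Ksp D0 dpr ppr Dd pd thd Kal nK Aval) => // z.
  exact: mem_croots.
Qed.

(** * Real values of the Mahler measure *)

Section RealEmbedding.
Variable R : realType.

Lemma algC_cut_ub (x : algC) : 0 <= x -> has_ubound (@ratr R @` [set q : rat | ratr q <= x]).
Proof.
move=> x0; exists (Num.bound x)%:R => _ [q /= qx <-].
rewrite -[leRHS](ratr_nat R) ler_rat -(ler_rat algC) ratr_nat.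
by apply: le_trans qx (ltW _); apply: archi_boundP.
Qed.

Lemma algC_to_real_ge (x : algC) q : 0 <= x -> ratr q <= x -> ratr q <= algC_to_real R x.
Proof. by move=> x0 qx; apply: ub_le_sup; [apply: algC_cut_ub | exists q]. Qed.

Lemma algC_to_real_le (x : algC) q : 0 <= x -> x <= ratr q -> algC_to_real R x <= ratr q.
Proof.
move=> x0 xq; apply: ge_sup.
  by exists (ratr 0), 0 => //=; rewrite raddf0.
by move=> _ [r /= rx <-]; rewrite ler_rat -(ler_rat algC); apply: le_trans rx xq.
Qed.

(** If the value were below y, a rational strictly between them could be neither above x nor at most
    x. *)
Lemma algC_to_real_gt (x : algC) (y : R) : 0 <= x ->
  (forall q : rat, x < ratr q -> y <= ratr q) -> y <= algC_to_real R x.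
Proof.
move=> x0 H; rewrite leNgt; apply/negP => /rat_in_itvoo[q].
rewrite in_itv /= => /andP[q1 q2].
have xr : x \is Num.real by rewrite realE x0.
have qr : (ratr q : algC) \is Num.real by rewrite Creal_Crat ?Crat_rat.
case: (real_ltP xr qr) => [/H|/(algC_to_real_ge x0)].
  by rewrite leNgt q2.
by rewrite leNgt q1.
Qed.

Lemma mahler_real_ge1 (a : algC) : 1 <= algC_to_real R (mahler_measure (min_zpoly a)).
Proof.
rewrite -(rmorph1 (ratr : {rmorphism rat -> R})); apply: algC_to_real_ge.
  exact: le_trans ler01 (mahler_ge1 a).
by rewrite rmorph1 mahler_ge1.
Qed.

Lemma weil_height_ge0 (a : algC) : 0 <= weil_height R a.
Proof. by rewrite /weil_height divr_ge0 // ln_ge0 // mahler_real_ge1. Qed.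

(** Logarithms in [mahler_lower] give n(d - 1) log p <= 2ndD (log n + log M), and d <= 2(d - 1)
    produces the constant 4. *)
Lemma ln_mahler_lower (K : set algC) (D d p : nat) (th al : algC) :
  qring K -> qspan D K -> (0 < D)%N -> prime d -> prime p -> (D < d)%N -> p != d ->
  th ^+ d = p%:R -> adjoin_root K d th al -> ~ K al ->
  ln p%:R / (4 * D%:R) - ln (alg_deg al)%:R <= ln (algC_to_real R (mahler_measure (min_zpoly al))).
Proof.
move=> Kq Ksp D0 dpr ppr Dd pd thd Kal nK.
have := mahler_lower Kq Ksp D0 dpr ppr Dd pd thd Kal nK; rewrite /=.
have := mahler_ge1 al; set M := mahler_measure _; set n := alg_deg al => M1 bound.
have n0 : (0 < n)%N := alg_deg_gt0 al.
rewrite -ler_expR lnK ?posrE; last by apply: lt_le_trans (mahler_real_ge1 al).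
(* M is replaced by an arbitrary rational above it, for which the bound can be carried from [algC]
   to R. *)
apply: algC_to_real_gt => [|x Mx]; first exact: le_trans ler01 M1.
have x1 : 1 <= (ratr x : R).
  rewrite -(rmorph1 (ratr : {rmorphism rat -> R})) ler_rat -(ler_rat algC) rmorph1.
  exact: le_trans M1 (ltW Mx).
have x0 : 0 < (ratr x : R) by apply: lt_le_trans x1.
rewrite -[leRHS]lnK ?posrE // ler_expR lerBlDr.
have : (p%:R : R) ^+ (n * d.-1) <= ((n`!)%:R ^+ 2 * (ratr x) ^+ (2 * n.-1)) ^+ (d * D).
  have : (p%:R : algC) ^+ (n * d.-1) <= ((n`!)%:R ^+ 2 * (ratr x) ^+ (2 * n.-1)) ^+ (d * D).
    apply: le_trans bound _; apply: lerXn2r; rewrite ?nnegrE ?mulr_ge0 ?exprn_ge0 //.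
    - exact: le_trans ler01 M1.
    - exact: le_trans (le_trans ler01 M1) (ltW Mx).
    rewrite ler_wpM2l ?exprn_ge0 // lerXn2r ?nnegrE ?(ltW Mx) //.
      exact: le_trans ler01 M1.
    exact: le_trans (le_trans ler01 M1) (ltW Mx).
  rewrite -!(ratr_nat algC) -!rmorphXn -rmorphM -rmorphXn ler_rat -(ler_rat R).
  by rewrite !(rmorphM, rmorphXn) /= !ratr_nat.
move=> le1; set y : R := ratr x in x0 x1 le1 *; clearbody y.
have np : (0 : R) < n%:R by rewrite ltr0n.
have pp : (0 : R) < p%:R by rewrite ltr0n prime_gt0.
have fle : (n`!)%:R <= n%:R ^+ n :> R.
  rewrite -natrX ler_nat; elim: (n) => // k IH; rewrite factS expnS leq_mul2l /=.
  by apply: leq_trans IH _; case: k => // k; rewrite leq_exp2r.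
have f0 : (0 : R) < (n`!)%:R by rewrite ltr0n fact_gt0.
(* Uses n! <= n^n and raises the exponent 2(n - 1) of y >= 1 to 2n. *)
have le2 : (p%:R : R) ^+ (n * d.-1) <= (n%:R * y) ^+ (2 * n * (d * D)).
  have x0' := ltW x0; have np' := ltW np; have f0' := ltW f0.
  have nx0 : 0 <= n%:R * y :> R by apply: mulr_ge0.
  have fx0 : 0 <= (n`!)%:R ^+ 2 * y ^+ (2 * n.-1) :> R.
    by apply: mulr_ge0; apply: exprn_ge0.
  apply: le_trans le1 _; rewrite [leRHS]exprM; apply: lerXn2r => //.
    by rewrite nnegrE exprn_ge0.
  rewrite exprMn; apply: ler_pM; rewrite ?exprn_ge0 //.
    by rewrite mulnC exprM; apply: lerXn2r; rewrite ?nnegrE ?exprn_ge0.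
  by apply: ler_weXn2l => //; rewrite leq_mul2l leq_pred orbT.
have : ln ((p%:R : R) ^+ (n * d.-1)) <= ln ((n%:R * y) ^+ (2 * n * (d * D))).
  by rewrite ler_ln ?posrE ?exprn_gt0 ?mulr_gt0.
rewrite !lnXn ?mulr_gt0 // lnM ?posrE // => le3.
have lp : 0 <= ln (p%:R : R) by rewrite ln_ge0 // ler1n prime_gt0.
have D0' : (0 : R) < D%:R by rewrite ltr0n.
rewrite ler_pdivrMr ?mulr_gt0 // addrC.
set S := ln n%:R + _ in le3 *; set P := ln p%:R in le3 lp *.
have d2 : (1 < d)%N := prime_gt1 dpr.
have n'0 : (0 : R) < (n * d)%:R by rewrite ltr0n muln_gt0 n0 prime_gt0.
rewrite -(ler_pM2l n'0).
have e1 : (n * d)%:R * P <= (2 * (n * d.-1))%:R * P.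
  rewrite ler_wpM2r // ler_nat mulnCA leq_mul2l; apply/orP; right.
  by move: d2; case: (d) => [|[|k]] // _; rewrite mul2n -addnn addnS addSn !ltnS leq_addl.
apply: (le_trans e1); rewrite natrM -mulrA [X in 2%:R * X]mulr_natl.
have -> : (n * d)%:R * (S * (4 * D%:R)) = 2 * (S *+ (2 * n * (d * D))).
  by rewrite -[S *+ _]mulr_natl !natrM; ring.
by rewrite ler_wpM2l.
Qed.

End RealEmbedding.

(** * Northcott's theorem in bounded degree *)

Lemma coef_prod_XsubC_le (s : seq algC) i :
  `|(\prod_(z <- s) ('X - z%:P))`_i| <= \prod_(z <- s) (2 * Num.max 1 `|z|).
Proof.
elim: s i => [|z s IH] i.
  rewrite !big_nil coef1; case: eqP => _; first by rewrite normr1.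
  by rewrite normr0 ler01.
rewrite !big_cons mulrBl coefB coefXM coefCM.
apply: le_trans (ler_normB _ _) _; rewrite normrM mulrDl mulrDl !mul1r.
set P := \prod_(z <- s) (2 * _).
have P0 : 0 <= P by apply: le_trans (IH 0%N); apply: normr_ge0.
apply: lerD.
  apply: (@le_trans _ _ P); first by case: ifP => _ //; rewrite normr0.
  by rewrite ler_peMl // max1_ge1.
by apply: ler_pM; rewrite ?normr_ge0 // max1_ge.
Qed.

(** By [coef_prod_XsubC_le] the coefficients of [min_zpoly a] are at most 2^N times its Mahler
    measure. This leaves finitely many polynomials, each with finitely many roots. *)
Lemma bounded_mahler_finite (N B : nat) :
  finite_set [set a : algC | (alg_deg a <= N)%N /\ mahler_measure (min_zpoly a) <= B%:R].
Proof.
pose C := (2 ^ N * B)%N.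
(* Subtracting C encodes the coefficients between -C and C by ordinals below 2C + 1. *)
pose P (g : {ffun 'I_N.+1 -> 'I_(2 * C).+1}) : {poly int} :=
  \poly_(i < N.+1) ((g (inord i))%:Z - C%:Z).
pose L := flatten [seq croots (map_poly intr (P g)) | g <- enum {: {ffun 'I_N.+1 -> 'I_(2 * C).+1}}].
apply: (@sub_finite_set _ _ [set` L]); last exact: finite_seq.
move=> a [aN aB] /=; set f := min_zpoly a in aB *.
have coefC i : (absz (f`_i)%R <= C)%N.
  have : `|(f`_i)%:~R| <= C%:R :> algC.
    have -> : (f`_i)%:~R = (map_poly intr f)`_i :> algC by rewrite coef_map.
    rewrite min_zpolyE coefZ normrM croots_min_zpoly.
    apply: le_trans (ler_wpM2l (normr_ge0 _) (coef_prod_XsubC_le _ _)) _.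
    rewrite big_split /= big_const_seq count_predT iter_mulr mulr1 size_croots mulrCA natrM.
    apply: ler_pM; rewrite ?exprn_ge0 //.
    - rewrite mulr_ge0 //; apply: prodr_ge0 => z _; exact: max1_ge0.
    - by rewrite -natrX ler_nat leq_exp2l.
  by rewrite -intr_norm pmulrn ler_int -abszE.
have sf : (size f <= N.+1)%N.
  have -> : size f = size (map_poly intr f : {poly algC}).
    by rewrite [RHS](size_map_inj_poly (@intr_inj algC)).
  rewrite min_zpolyE size_scale ?intr_eq0 ?lead_min_zpoly //.
  by rewrite -(prednK (ltnW (size_minCpoly a))) ltnS.
have gP i : (absz (f`_i + C%:Z)%R < (2 * C).+1)%N by have := coefC i; lia.
pose g := [ffun i : 'I_N.+1 => Ordinal (gP i)].
have Pg : P g = f.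
  apply/polyP => i; rewrite coef_poly; case: ltnP => iN; last by rewrite nth_default // (leq_trans sf).
  rewrite ffunE /= inordK //; move: (f`_i) (coefC i) => z zC; lia.
apply/flattenP; exists (croots (map_poly intr f)); last by rewrite mem_croots root_minCpoly.
by apply/mapP; exists g; rewrite ?mem_enum ?Pg.
Qed.

(** * Bounds for weighted heights *)

Section WeightedHeight.
Variable R : realType.

Lemma weighted_heightE (gamma : R) (a : algC) :
  weighted_height gamma a =
    (alg_deg a)%:R `^ (gamma - 1) * ln (algC_to_real R (mahler_measure (min_zpoly a))).
Proof.
have n0 : ((alg_deg a)%:R : R) != 0 by rewrite pnatr_eq0 -lt0n alg_deg_gt0.
by rewrite /weighted_height /weil_height powRB ?n0 ?implybT // powRr1 // mulrA mulrAC.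
Qed.

Lemma powR_neg_le (s x y : R) : 0 <= s -> 0 < x -> x <= y -> y `^ (- s) <= x `^ (- s).
Proof.
move=> s0 x0 xy; have y0 := lt_le_trans x0 xy.
rewrite !powRN lef_pV2 ?posrE ?powR_gt0 //.
by apply: ge0_ler_powR => //; rewrite nnegrE ltW.
Qed.

(** The degree n of al is at most dD, and neither n^(gamma - 1) nor the bound of [ln_mahler_lower]
    increases with n, the former because gamma <= 1. *)
Lemma weighted_height_lower (gamma : R) (K : set algC) (D d p : nat) (th al : algC) :
  gamma <= 1 ->
  qring K -> qspan D K -> (0 < D)%N -> prime d -> prime p -> (D < d)%N -> p != d ->
  th ^+ d = p%:R -> adjoin_root K d th al -> ~ K al ->
  0 <= ln p%:R / (4 * D%:R) - ln (d * D)%:R :> R ->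
  (d * D)%:R `^ (gamma - 1) * (ln p%:R / (4 * D%:R) - ln (d * D)%:R) <=
    weighted_height gamma al.
Proof.
move=> g1 Kq Ksp D0 dpr ppr Dd pd thd Kal nK B0.
have d0 := prime_gt0 dpr; have Kp := qring_nat Kq p.
have [q [q0 sq rq]] := qspan_alg (adjoin_root_qring Kq d0 Kp thd) (adjoin_root_span d th Ksp) Kal.
have nle := alg_deg_le q0 sq rq; have n0 := alg_deg_gt0 al.
have lb := ln_mahler_lower R Kq Ksp D0 dpr ppr Dd pd thd Kal nK.
rewrite weighted_heightE; apply: ler_pM => //.
  rewrite -(opprB 1 gamma); apply: powR_neg_le; rewrite ?subr_ge0 ?ltr0n ?ler_nat //.
apply: le_trans lb; rewrite lerD2l lerN2 ler_ln ?posrE ?ltr0n ?ler_nat //.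
by rewrite muln_gt0 d0.
Qed.

Lemma northcott_bounded (gamma X : R) (N : nat) : 0 < gamma ->
  finite_set [set a : algC | (alg_deg a <= N)%N /\ weighted_height gamma a <= X].
Proof.
(* Since the degree to the power gamma is at least 1, the height is at most max(X, 0), and log M at
   most N times this. *)
move=> g0; pose Y := expR (Num.max X 0 * N%:R).
have Y0 : 0 <= Y by apply: expR_ge0.
apply: (@sub_finite_set _ _ [set a | (alg_deg a <= N)%N /\ mahler_measure (min_zpoly a) <= (Num.bound Y)%:R]);
  last exact: bounded_mahler_finite.
move=> a [aN aX]; split=> //; set M := mahler_measure _.
have M1 : 1 <= M := mahler_ge1 a; have M0 : 0 <= M := le_trans ler01 M1.
have MY : algC_to_real R M <= Y.
  have r1 := mahler_real_ge1 R a; rewrite -/M in r1.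
  rewrite -ler_ln ?posrE ?expR_gt0 ?(lt_le_trans ltr01 r1) // expRK.
  have n0 : (0 : R) < (alg_deg a)%:R by rewrite ltr0n alg_deg_gt0.
  have hX : weil_height R a <= Num.max X 0.
    rewrite le_max; apply/orP; left; apply: le_trans aX.
    rewrite /weighted_height ler_peMl ?weil_height_ge0 //.
    have : 1 `^ gamma <= (alg_deg a)%:R `^ gamma :> R; last by rewrite powR1.
    apply: ge0_ler_powR; rewrite ?nnegrE ?ler1n ?alg_deg_gt0 //; exact: ltW.
  have -> : ln (algC_to_real R M) = weil_height R a * (alg_deg a)%:R.
    by rewrite /weil_height divfK // gt_eqF.
  by apply: ler_pM => //; rewrite ?weil_height_ge0 ?ler_nat.
have Mr : M \is Num.real by rewrite realE M0.
case: (real_leP Mr (realn _ (Num.bound Y))) => // BM.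
have : (Num.bound Y)%:R <= algC_to_real R M.
  by rewrite -(ratr_nat R); apply: algC_to_real_ge => //; rewrite ratr_nat ltW.
by rewrite leNgt (le_lt_trans MY) // archi_boundP.
Qed.

End WeightedHeight.

(** * A prime between N and 2 N^2 *)

Lemma logn_fact_wide p m n : prime p -> (m <= n)%N ->
  logn p m`! = (\sum_(1 <= k < n.+1) m %/ p ^ k)%N.
Proof.
move=> pp mn; rewrite logn_fact // [RHS](@big_cat_nat _ _ _ m.+1) //=.
rewrite [X in (_ + X)%N]big_nat_cond [X in (_ + X)%N]big1 ?addn0 // => k /andP[/andP[mk _] _].
by rewrite divn_small // (leq_ltn_trans (ltnW mk)) // ltn_expl // prime_gt1.
Qed.

Lemma divn_double_le m q : (0 < q)%N -> ((2 * m) %/ q <= 2 * (m %/ q) + 1)%N.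
Proof.
move=> q0; rewrite -ltnS ltn_divLR //.
by have := divn_eq m q; have := ltn_pmod m q0; nia.
Qed.

(** In Legendre's formula each k contributes at most 1 to the exponent e, and nothing when p^k > 2m.
    If p^e > 2m, at most e - 1 values of k contribute, a contradiction. *)
Lemma logn_central_bin p m : prime p -> (0 < m)%N -> (p ^ logn p 'C(2 * m, m) <= 2 * m)%N.
Proof.
move=> pp m0; set n := (2 * m)%N; set e := logn p _.
have mn : (m <= n)%N by rewrite /n; lia.
have n_m : (n - m = m)%N by rewrite /n; lia.
have C0 : (0 < 'C(n, m))%N by rewrite bin_gt0.
have En : (e + 2 * logn p m`! = logn p n`!)%N.
  rewrite -(bin_fact mn) n_m lognM // ?muln_gt0 ?fact_gt0 //.
  by rewrite lognM ?fact_gt0 // mul2n addnn.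
rewrite leqNgt; apply/negP => ne.
have e0 : (0 < e)%N by rewrite lt0n; apply: contraTneq ne => ->; rewrite expn0 /n; lia.
have big0k a b k : (e <= k)%N -> (b <= n)%N -> a = (b %/ p ^ k)%N -> a = 0%N.
  move=> ek bn ->; rewrite divn_small // (leq_ltn_trans bn) // (leq_trans ne) //.
  by rewrite leq_pexp2l // prime_gt0.
have : (logn p n`! <= 2 * logn p m`! + e.-1)%N; last by lia.
rewrite (logn_fact_wide pp (leqnn n)) (logn_fact_wide pp mn).
have step : (\sum_(1 <= k < n.+1) n %/ p ^ k <=
    \sum_(1 <= k < n.+1) (2 * (m %/ p ^ k) + (k < e)%N))%N.
  apply: leq_sum => k _; case: ltnP => ke.
    by apply: divn_double_le; rewrite expn_gt0 prime_gt0.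
  by rewrite (big0k _ n k ke (leqnn _) erefl).
apply: leq_trans step _; rewrite big_split /= -big_distrr /= leq_add2l.
have -> : (\sum_(1 <= k < n.+1) (k < e))%N = count (fun k => (k < e)%N) (index_iota 1 n.+1).
  by rewrite -sum1_count [RHS]big_mkcond; apply: eq_bigr => k _; case: ltnP.
rewrite -size_filter -[leqRHS](size_iota 1); apply: uniq_leq_size.
  by rewrite filter_uniq // iota_uniq.
move=> k; rewrite mem_filter mem_index_iota mem_iota => /andP[ke /andP[k1 _]].
by rewrite k1 add1n prednK.
Qed.

Lemma central_bin_ge m : (2 ^ m <= 'C(2 * m, m))%N.
Proof.
have n_m : (2 * m - m = m)%N by lia.
have f0 : (0 < m`! * m`!)%N by rewrite muln_gt0 fact_gt0.
have mn : (m <= 2 * m)%N by lia.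
have := bin_fact mn; rewrite n_m -(leq_pmul2r f0) => ->.
elim: m {n_m f0 mn} => // m IH.
have -> : (2 * m.+1 = (2 * m).+2)%N by lia.
rewrite !factS expnS.
move: (2 ^ m)%N (m`!)%N ((2 * m)`!)%N IH => a b c IH.
have -> : (2 * a * (m.+1 * b * (m.+1 * b)) = (2 * m.+1 * m.+1) * (a * (b * b)))%N by ring.
have -> : ((2 * m).+2 * ((2 * m).+1 * c) = (2 * m.+1 * (2 * m).+1) * c)%N by ring.
apply: leq_mul => //; rewrite leq_mul2l; apply/orP; right; lia.
Qed.

Lemma double_sqr_lt_expn N : (7 <= N)%N -> (2 * N ^ 2 < 2 ^ N)%N.
Proof.
move=> N7; rewrite -(subnK N7); elim: (N - 7)%N => // k IH.
rewrite addSn [ltnRHS]expnS; apply: (@leq_ltn_trans (2 * (2 * (k + 7) ^ 2))).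
  by rewrite !expnS !expn0; nia.
by rewrite ltn_pmul2l.
Qed.

Lemma prime_dvd_fact p n : prime p -> (p %| n`!)%N -> (p <= n)%N.
Proof.
move=> pp; elim: n => [|n IH]; first by rewrite fact0 dvdn1 => /eqP p1; rewrite p1 in pp.
rewrite factS Euclid_dvdM // => /orP[/dvdn_leq->//|/IH/leqW//].
Qed.

(** Chebyshev's argument with m = N^2: without such a prime, the central binomial coefficient has at
    most N prime divisors, each to a power at most 2m. Then 2^m <= (2m)^N, that is 2^N <= 2N^2,
    false from N = 7 on. *)
Lemma prime_between N : (7 <= N)%N -> exists2 p, prime p & (N < p <= 2 * N ^ 2)%N.
Proof.
move=> N7; set m := (N ^ 2)%N; have m0 : (0 < m)%N by rewrite expn_gt0; lia.
apply: contrapT => H; set C := 'C(2 * m, m).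
have C0 : (0 < C)%N by rewrite bin_gt0; lia.
have small p : p \in primes C -> (p <= N)%N.
  rewrite mem_primes => /and3P[pp _ pC]; rewrite leqNgt; apply/negP => Np; apply: H.
  exists p => //; rewrite Np /= -/m.
  have : (p %| (2 * m)`!)%N by rewrite -(@bin_fact _ m) ?dvdn_mulr //; lia.
  exact: prime_dvd_fact.
have CE : (C <= (2 * m) ^ N)%N.
  rewrite {1}(prod_prime_decomp C0) prime_decompE big_map /=.
  apply: (@leq_trans ((2 * m) ^ size (primes C))); last first.
    rewrite leq_pexp2l //; first by lia.
    rewrite -[leqRHS](size_iota 1); apply: uniq_leq_size; first exact: primes_uniq.
    move=> p pC; rewrite mem_iota add1n ltnS small // andbT.
    by move: pC; rewrite mem_primes => /and3P[/prime_gt0].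
  rewrite -sum1_size expn_sum !big_seq; apply: leq_prod => p pC.
  by rewrite expn1; apply: logn_central_bin => //; move: pC; rewrite mem_primes => /and3P[].
have N0 : (0 < N)%N by apply: leq_trans N7.
have := leq_trans (central_bin_ge m) CE.
have -> : (2 ^ m = (2 ^ N) ^ N)%N by rewrite -expnM mulnn.
by rewrite leq_exp2r // leqNgt double_sqr_lt_expn.
Qed.

(** * Choice of the degree and of the radicand *)

Lemma ln_le_subr1 (R : realType) (x : R) : 0 < x -> ln x <= x - 1.
Proof.
move=> x0; have := expR_ge1Dx (ln x); rewrite lnK ?posrE // => h.
by rewrite lerBrDl.
Qed.

(** With N just above e^L, [prime_between] gives p <= 2N^2 <= 8 e^(2L) <= e^(4L), since N <= 2 e^L
    and e^L >= 8. *)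
Lemma prime_near_expR (R : realType) (L : R) : 7 <= L ->
  exists2 p, prime p & L < ln (p%:R : R) <= 4 * L.
Proof.
move=> L7; have e0 : 0 < expR L := expR_gt0 L.
have eL : 1 + L <= expR L := expR_ge1Dx L.
have := truncn_itv (ltW e0); set N := (Num.trunc _).+1 => /andP[N1 N2].
have N7 : (7 <= N)%N by rewrite -(ler_nat R); apply: le_trans (ltW N2); lra.
have [p pp /andP[Np p2]] := prime_between N7; exists p => //.
have p0 : (0 : R) < p%:R by rewrite ltr0n prime_gt0.
apply/andP; split.
  by rewrite -ltr_expR lnK ?posrE //; apply: lt_trans N2 _; rewrite ltr_nat.
have Nle : (N%:R : R) <= 2 * expR L.
  by rewrite /N -natr1; lra.
have e8 : 8 <= expR L by lra.
rewrite -ler_expR lnK ?posrE //.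
have -> : expR (4 * L) = expR L ^+ 4.
  by rewrite -expRM_natl mulrC.
apply: (@le_trans _ _ (2 * (2 * expR L) ^+ 2)).
  apply: (@le_trans _ _ (2 * N ^ 2)%:R); first by rewrite ler_nat.
  by rewrite natrM natrX ler_wpM2l // lerXn2r ?nnegrE // mulr_ge0 // ltW.
move: (expR L) e8 => y y8.
have -> : y ^+ 4 = (y * y) * (y ^+ 2) by ring.
have -> : 2 * (2 * y) ^+ 2 = 8 * y ^+ 2 by ring.
by apply: ler_wpM2r; [apply: sqr_ge0 | nra].
Qed.

Lemma large_prime (R : realType) (T : R) (D : nat) :
  exists d, [/\ prime d, (D < d)%N & T <= d%:R].
Proof.
have [d dM dpr] := prime_above (maxn D (Num.bound `|T|)); exists d; split=> //.
  by apply: leq_ltn_trans dM; apply: leq_maxl.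
apply: le_trans (ler_norm T) _; apply: le_trans (ltW (archi_boundP (normr_ge0 T))) _.
by rewrite ler_nat; apply/ltnW; apply: leq_ltn_trans dM; apply: leq_maxr.
Qed.

(** d is taken with w = d^(eps/4) large, and log p between L and 4L for L = d^(1 - gamma) w^2. The
    factor w^2 makes the lower bound grow, while the last quantity is at most 4 / w^2. *)
Lemma parameters (R : realType) (gamma eps : R) : 0 < gamma -> gamma <= 1 -> 0 < eps ->
  forall (D i : nat), (0 < D)%N -> exists d p,
  [/\ prime d, prime p, (D < d)%N, p != d &
   [/\ 0 <= ln p%:R / (4 * D%:R) - ln (d * D)%:R :> R,
      i%:R <= (d * D)%:R `^ (gamma - 1) * (ln p%:R / (4 * D%:R) - ln (d * D)%:R) &
      d%:R `^ (gamma - eps - 1) * ln p%:R <= (i.+1)%:R^-1 :> R]].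
Proof.
move=> g0 g1 e0 D i D0.
have DR : (1 : R) <= D%:R by rewrite ler1n.
have iR : (0 : R) <= i%:R by rewrite ler0n.
pose del := eps / 2; have del0 : 0 < del by rewrite divr_gt0.
(* From w >= T: a w / (4D) absorbs the error 4w / del in X below, b / (4D) is D i, and 4i + 12 makes
   w^2 at least 4(i + 1). *)
pose a : R := 16 * D%:R / del; have a0 : 0 <= a.
  by rewrite /a divr_ge0 ?mulr_ge0 // ltW.
pose b : R := 4 * D%:R ^+ 2 * i%:R; have b0 : 0 <= b.
  by rewrite /b !mulr_ge0 ?sqr_ge0.
pose T : R := a + b + 4 * i%:R + 12.
have [d [dpr Dd Td]] := large_prime (T `^ (del / 2)^-1) D.
have d1 : (1 : R) <= d%:R by rewrite ler1n prime_gt0.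
have d0 : (0 : R) < d%:R by apply: lt_le_trans d1.
have dn0 : (d%:R : R) != 0 by rewrite gt_eqF.
pose w : R := d%:R `^ (del / 2).
have T1 : 12 <= T by rewrite /T; lra.
have del2 : 0 < del / 2 by rewrite divr_gt0.
have wT : T <= w.
  have -> : T = (T `^ (del / 2)^-1) `^ (del / 2).
    by rewrite -powRrM mulVf ?powRr1 ?gt_eqF //; lra.
  apply: ge0_ler_powR => //; first exact: ltW.
    by rewrite nnegrE powR_ge0.
  by rewrite nnegrE ltW.
have w0 : 0 < w by lra.
(* log d is a multiple of log w, hence at most linear in w, whereas L is at least w^2. *)
have lnd : ln d%:R <= 2 / del * w :> R.
  have -> : ln d%:R = 2 / del * ln w :> R.
    by rewrite /w ln_powR; field; rewrite gt_eqF.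
  apply: ler_wpM2l; first by rewrite divr_ge0 // ltW.
  by have := ln_le_subr1 w0; lra.
pose s := 1 - gamma; have s0 : 0 <= s by rewrite subr_ge0.
have s1 : s <= 1 by rewrite /s; lra.
pose ds : R := d%:R `^ s; have ds1 : 1 <= ds.
  by rewrite -(powRr0 (d%:R : R)); apply: ler_powR.
have D2 : 0 < (D%:R : R) by lra.
pose c : R := del^-1; have c0 : 0 < c by rewrite invr_gt0.
have ac : a = 16 * D%:R * c by [].
have wa : a + b + 4 * i%:R + 12 <= w by exact: wT.
have w12 : 12 <= w by apply: le_trans wT.
have w2 : a * w + b * w + 4 * (i%:R * w) + 12 * w <= w ^+ 2.
  have -> : a * w + b * w + 4 * (i%:R * w) + 12 * w = (a + b + 4 * i%:R + 12) * w by ring.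
  by rewrite expr2; apply: ler_wpM2r => //; exact: ltW.
have aw0 : 0 <= a * w by apply: mulr_ge0 => //; apply: ltW.
have bw0 : 0 <= b * w by apply: mulr_ge0 => //; apply: ltW.
(* [ds * X] will bound log p / (4D) - log(dD) from below, because log(dD) <= 2 log d <= 4cw and ds
   >= 1. *)
pose X := w ^+ 2 / (4 * D%:R) - 4 * c * w.
have bw : b <= b * w by apply: ler_peMr => //; lra.
have iw : 0 <= i%:R * w by apply: mulr_ge0 => //; apply: ltW.
have XD : D%:R * i%:R <= X.
  rewrite /X lerBrDl ler_pdivlMr ?mulr_gt0 //.
  have -> : (4 * c * w + D%:R * i%:R) * (4 * D%:R) = a * w + b.
    by rewrite ac /b; ring.
  by apply: le_trans w2; lra.
have X0 : 0 <= X by apply: le_trans XD; apply: mulr_ge0; lra.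
have w2_7 : 7 <= w ^+ 2.
  by apply: le_trans w2; lra.
pose L := ds * w ^+ 2.
have Lw : w ^+ 2 <= L by apply: ler_peMl => //; apply: sqr_ge0.
have [|p pp /andP[Lp pL]] := @prime_near_expR R L; first exact: le_trans Lw.
exists d, p.
have lnd2 : ln d%:R <= 2 * c * w :> R by [].
have cw0 : 0 <= c * w by apply: mulr_ge0; apply: ltW.
have lnD : ln (D%:R : R) <= ln d%:R by rewrite ler_ln ?posrE // ler_nat ltnW.
have lndD : ln (d * D)%:R <= 4 * c * w :> R.
  by rewrite natrM lnM ?posrE //; lra.
have BX : ds * X <= ln p%:R / (4 * D%:R) - ln (d * D)%:R.
  apply: (@le_trans _ _ (L / (4 * D%:R) - 4 * c * w)).
    have -> : ds * X = L / (4 * D%:R) - ds * (4 * c * w) by rewrite /X /L; ring.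
    rewrite lerD2l lerN2; apply: ler_peMl => //; lra.
  apply: lerB => //; apply: ler_wpM2r; last exact: ltW.
  by rewrite invr_ge0; lra.
have dX0 : 0 <= ds * X by apply: mulr_ge0 => //; lra.
have ds0 : 0 < ds by lra.
split=> //.
  (* If p = d, then log d > L >= w^2 >= a w >= 2cw >= log d. *)
  apply/eqP => pd; move: Lp; rewrite pd => Lp.
  have : a * w <= w ^+ 2.
    by apply: le_trans w2; lra.
  have : 2 * c * w <= a * w.
    rewrite ac; apply: ler_wpM2r; first exact: ltW.
    by apply: ler_wpM2r; [apply: ltW | lra].
  lra.
split.
- exact: le_trans BX.
(* [ds^-1] cancels the factor [ds] of the bound, and D^(-s) >= 1/D since s <= 1; what remains is X /
   D >= i. *)
- have -> : (d * D)%:R `^ (gamma - 1) = ds^-1 * D%:R `^ (- s) :> R.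
    rewrite natrM powRM ?ler0n // -(opprB 1 gamma) -/s; congr (_ * _).
    by rewrite powRN.
  have Ds : D%:R^-1 <= D%:R `^ (- s) :> R.
    by rewrite -powR_inv1; [apply: ler_powR => //; rewrite lerN2 | apply: ltW].
  apply: (@le_trans _ _ (ds^-1 * D%:R^-1 * (ds * X))).
    have -> : ds^-1 * D%:R^-1 * (ds * X) = X / D%:R by field; rewrite !gt_eqF.
    by rewrite ler_pdivlMr // mulrC.
  apply: ler_pM => //; first by apply: mulr_ge0; rewrite invr_ge0 ltW.
  by apply: ler_wpM2l => //; rewrite invr_ge0 ltW.
- have -> : d%:R `^ (gamma - eps - 1) = (ds * w ^+ 4)^-1 :> R.
    have -> : w ^+ 4 = d%:R `^ eps.
      rewrite /w -powR_mulrn ?powR_ge0 // -powRrM; congr (_ `^ _).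
      by rewrite /del; field.
    rewrite -powRD ?dn0 ?implybT // -powRN; congr (_ `^ _); rewrite /s; lra.
  have i0 : (0 : R) < (i.+1)%:R by rewrite ltr0n.
  rewrite mulrC ler_pdivrMr; last by apply: mulr_gt0 => //; apply: exprn_gt0.
  apply: le_trans pL _.
  have -> : (i.+1)%:R^-1 * (ds * w ^+ 4) = L * (w ^+ 2 / (i.+1)%:R).
    rewrite /L; field; exact: lt0r_neq0.
  rewrite mulrC; apply: ler_wpM2l; first by lra.
  rewrite ler_pdivlMr // -natr1; apply: le_trans w2.
  have : i%:R <= i%:R * w by apply: ler_peMr => //; lra.
  lra.
Qed.

(** * The tower of radical extensions *)

Definition rationals : set algC := [set x | x \in Crat].

Lemma rationals_qring : qring rationals.
Proof.
split=> [q|x y|x y] /=; rewrite /rationals /=; first exact: Crat_rat.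
  exact: rpredB.
exact: rpredM.
Qed.

Lemma rationals_span : qspan 1 rationals.
Proof.
exists unit, (fun=> 1); split; first by rewrite card_unit.
move=> x /CratP[q ->]; exists (fun=> q).
by rewrite (big_pred1 tt) ?mulr1 // => -[].
Qed.

(** * The height of a radical *)

Section RadicalHeight.
Variables (d p : nat) (th : algC).
Hypotheses (dpr : prime d) (ppr : prime p) (thd : th ^+ d = p%:R).

Let g : {poly int} := 'X^d - (p%:Z)%:P.

Let g_monic : g \is monic.
Proof. by rewrite monicXnsubC // prime_gt0. Qed.

Let size_g : size g = d.+1.
Proof. by rewrite size_XnsubC // prime_gt0. Qed.

(** A minimal polynomial of degree below d would be a rational relation among 1, ..., th^(d-1),
    excluded by [kummer_free] with K = Q and D = 1. *)
Lemma radical_minCpoly : minCpoly th = map_poly intr g.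
Proof.
have [q [Dq qmon] qP] := minCpolyP th; rewrite Dq.
pose G : {poly rat} := map_poly intr g.
have mapG : map_poly ratr G = map_poly intr g :> {poly algC}.
  by rewrite -map_poly_comp; apply: eq_map_poly => c; rewrite /= ratr_int.
have Gmon : G \is monic by apply: monic_map.
have sG : size G = d.+1 by rewrite size_map_poly_id0 ?(monicP g_monic) ?oner_eq0.
have qG : q %| G.
  rewrite -qP mapG /g rmorphB /= map_polyXn map_polyC /= rootE !hornerE thd.
  by rewrite -pmulrn subrr.
rewrite -mapG; congr (map_poly ratr _); apply/eqP.
rewrite -eqp_monic // -(dvdp_size_eqp qG) sG.
have := dvdp_leq (monic_neq0 Gmon) qG; rewrite sG leq_eqVlt ltnS => /orP[//|sq].
have free := @kummer_free rationals 1 d p th rationals_qring rationals_span dpr ppr (prime_gt1 dpr) thd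
   (fun i => ratr q`_i) (fun i => Crat_rat _).
have q0 := monic_neq0 qmon; case/eqP: (q0).
have : root (map_poly ratr q) th by rewrite qP.
rewrite /root (@horner_coef_wide _ d); last by rewrite size_map_poly.
under eq_bigr do rewrite coef_map.
move=> /eqP /free z; apply/polyP => i; rewrite coef0.
have [id|di] := ltnP i d; last by rewrite nth_default // (leq_trans sq).
by have /eqP := z i id; rewrite fmorph_eq0 => /eqP.
Qed.

Lemma radical_alg_deg : alg_deg th = d.
Proof.
rewrite /alg_deg radical_minCpoly size_map_poly_id0 ?size_g //.
by rewrite (monicP g_monic) oner_eq0.
Qed.

Lemma radical_min_zpoly : min_zpoly th = g.
Proof.
rewrite /min_zpoly; case: (minCpolyP th) => q [Dq qmon] qP /=.
case: (rat_poly_scale q) => q' [c c0 Dq'] /=.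
have -> : q' = c *: g; last by rewrite zprimitiveZ // zprimitive_monic.
apply: (@map_inj_poly _ _ (intr : int -> algC)) => //; first exact: intr_inj.
rewrite map_polyZ /= -radical_minCpoly Dq Dq' map_polyZ /=.
have cE : (c%:~R : algC) != 0 by rewrite intr_eq0.
have -> : ratr c%:~R^-1 = c%:~R^-1 :> algC by rewrite fmorphV /= ratr_int.
rewrite scalerA divff // scale1r -map_poly_comp.
by apply: eq_map_poly => x; rewrite /= ratr_int.
Qed.

(** All roots have absolute value p^(1/d) > 1, so the product of the max(1, |z|) is the absolute
    value of the constant coefficient. *)
Lemma radical_mahler : mahler_measure (min_zpoly th) = p%:R.
Proof.
have E := croots_min_zpoly th; rewrite radical_min_zpoly in E *.
rewrite /mahler_measure (monicP g_monic) normr1 mul1r.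
set s := croots _ in E *.
have gE : map_poly intr g = 'X^d - (p%:R)%:P :> {poly algC}.
  by rewrite /g rmorphB /= map_polyXn map_polyC /= -pmulrn.
have p1 : (1 : algC) <= p%:R by rewrite ler1n prime_gt0.
have zs z : z \in s -> Num.max 1 `|z| = `|z|.
  rewrite -root_prod_XsubC -E radical_minCpoly gE rootE !hornerE subr_eq0 => /eqP zd.
  have zp : `|z| ^+ d = p%:R by rewrite -normrX zd normr_nat.
  rewrite /Num.max; case: ifP => // /negbT h.
  have z1 : `|z| <= 1 by rewrite real_leNgt ?realE ?normr_ge0 ?ler01.
  have : `|z| ^+ d <= 1 by rewrite exprn_ile1.
  by rewrite zp lern1 leqNgt prime_gt1.
rewrite big_seq (eq_bigr (fun z => `|z|)) -?big_seq //.
have := congr1 (fun r : {poly algC} => `|r.[0]|) E.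
rewrite radical_minCpoly gE !hornerE expr0n gtn_eqF ?prime_gt0 //= sub0r normrN normr_nat => ->.
rewrite horner_prod normr_prod; apply: eq_bigr => z _.
by rewrite !hornerE ?sub0r normrN.
Qed.

Lemma radical_weighted_height (R : realType) (gamma : R) :
  weighted_height gamma th = d%:R `^ (gamma - 1) * ln p%:R.
Proof.
rewrite weighted_heightE radical_alg_deg radical_mahler; congr (_ * ln _).
have p0 : (0 : algC) <= p%:R by rewrite ler0n.
rewrite -[RHS](ratr_nat R); apply/eqP; rewrite eq_le; apply/andP; split.
  by apply: algC_to_real_le => //; rewrite ratr_nat.
by apply: algC_to_real_ge => //; rewrite ratr_nat.
Qed.

End RadicalHeight.

Lemma limit_point0P (R : realType) (E : set R) :
  (forall e : R, 0 < e -> exists2 y, E y & 0 < y < e) -> limit_point E 0.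
Proof.
move=> H U /nbhs_ballP[e /= e0 eU]; have [y Ey /andP[y0 ye]] := H e e0.
exists y; split=> //; first by rewrite gt_eqF.
by apply: eU; rewrite /ball /= sub0r normrN ger0_norm // ltW.
Qed.

Lemma qring_divring (K : set algC) : qring K -> divring_closed (fun x => `[< K x >]).
Proof.
move=> Kq; split.
- by apply/asboolP; apply: qring1 Kq.
- by move=> x y /asboolP Kx /asboolP Ky; apply/asboolP/(qringB Kq).
- move=> x y /asboolP Kx /asboolP Ky; apply/asboolP/(qringM Kq) => //; exact: (qringV Kq).
Qed.

Section Tower.
Variables (dd pp : nat -> nat -> nat).
Hypothesis dpP : forall D i, (0 < D)%N ->
  [/\ prime (dd D i), prime (pp D i) & (D < dd D i)%N].

(** A bound for the degree of [tower i], computed before the fields because the choice of the next d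
    and p depends on it. *)
Fixpoint tower_deg (i : nat) : nat :=
  if i is j.+1 then (dd (tower_deg j) j * tower_deg j)%N else 1%N.

Definition tower_d i := dd (tower_deg i) i.
Definition tower_p i := pp (tower_deg i) i.
Definition tower_root i : algC := (tower_d i).-root (tower_p i)%:R.

Fixpoint tower (i : nat) : set algC :=
  if i is j.+1 then adjoin_root (tower j) (tower_d j) (tower_root j) else rationals.

Lemma tower_deg_gt0 i : (0 < tower_deg i)%N.
Proof.
elim: i => //= i IH; rewrite muln_gt0 IH andbT.
by have [dpr _ _] := dpP i IH; apply: prime_gt0.
Qed.

Lemma tower_d_prime i : prime (tower_d i).
Proof. by have [] := dpP i (tower_deg_gt0 i). Qed.

Lemma tower_rootX i : tower_root i ^+ tower_d i = (tower_p i)%:R.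
Proof. by rewrite rootCK // prime_gt0 // tower_d_prime. Qed.

Lemma tower_qring i : qring (tower i).
Proof.
elim: i => [|i IH]; first exact: rationals_qring.
apply: (adjoin_root_qring IH (prime_gt0 (tower_d_prime i)) (qring_nat IH (tower_p i))).
exact: tower_rootX.
Qed.

Lemma tower_span i : qspan (tower_deg i) (tower i).
Proof. by elim: i => [|i IH]; [apply: rationals_span | apply: adjoin_root_span]. Qed.

Lemma tower_le i j : (i <= j)%N -> tower i `<=` tower j.
Proof.
move=> /subnK <-; elim: (j - i)%N => // k IH x /IH.
exact: (adjoin_root_base (tower_qring _) (prime_gt0 (tower_d_prime _))).
Qed.

Lemma tower_root_in i : tower i.+1 (tower_root i).
Proof.
have Kq := tower_qring i.
exact: (adjoin_root_gen Kq (prime_gt0 (tower_d_prime i)) (qring_nat Kq _) (tower_rootX i)).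
Qed.

Definition tower_union : set algC := \bigcup_i tower i.

Lemma tower_union_qring : qring tower_union.
Proof.
split=> [q|x y [i _ ix] [j _ jy]|x y [i _ ix] [j _ jy]].
- by exists 0%N => //; apply: (qring_rat rationals_qring).
- exists (maxn i j) => //; apply: (qringB (tower_qring _)).
    exact: tower_le (leq_maxl _ _) _ ix.
  exact: tower_le (leq_maxr _ _) _ jy.
- exists (maxn i j) => //; apply: (qringM (tower_qring _)).
    exact: tower_le (leq_maxl _ _) _ ix.
  exact: tower_le (leq_maxr _ _) _ jy.
Qed.

Lemma tower_step x i : tower_union x -> ~ tower i x ->
  exists2 j, (i <= j)%N & tower j.+1 x /\ ~ tower j x.
Proof.
move=> [k _ kx] nix; elim: k kx => [x0|k IH kx].
  by case: nix; apply: tower_le x0.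
have [/IH//|nk] := pselect (tower k x); exists k => //.
by rewrite leqNgt; apply/negP => ki; apply: nix; apply: tower_le ki _ kx.
Qed.

End Tower.

Theorem proposition1 (R : realType) (gamma epsilon : R)
    (hgamma0 : 0 < gamma) (hgamma1 : gamma <= 1) (hepsilon : 0 < epsilon) :
  exists L : {pred algC},
    [/\ divring_closed L,
        northcott gamma [set a | a \in L] &
        ~ bogomolov (gamma - epsilon) [set a | a \in L]].
Proof.
have /choice[f fP] : forall u : nat * nat, exists v : nat * nat, (0 < u.1)%N ->
  [/\ prime v.1, prime v.2, (u.1 < v.1)%N, v.2 != v.1 &
   [/\ 0 <= ln v.2%:R / (4 * u.1%:R) - ln (v.1 * u.1)%:R :> R,
      u.2%:R <= (v.1 * u.1)%:R `^ (gamma - 1) * (ln v.2%:R / (4 * u.1%:R) - ln (v.1 * u.1)%:R) &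
      v.1%:R `^ (gamma - epsilon - 1) * ln v.2%:R <= (u.2.+1)%:R^-1 :> R]].
  (* The pair (0, 0) is a dummy for the degree bound 0, where nothing is required. *)
  move=> [[|D] i]; first by exists (0, 0)%N.
  have [d [p H]] := parameters hgamma0 hgamma1 hepsilon i (ltn0Sn D).
  by exists (d, p).
pose dd D i := (f (D, i)).1; pose pp D i := (f (D, i)).2.
have dpP D i : (0 < D)%N -> [/\ prime (dd D i), prime (pp D i) & (D < dd D i)%N].
  by move=> D0; have [] := fP (D, i) D0.
have Kq := tower_qring dpP; have D0 := tower_deg_gt0 dpP.
pose L := tower_union dd pp.
exists (fun x => `[< L x >]); split.
- exact/qring_divring/tower_union_qring.
(* Elements of L outside [tower i] have weighted height at least i > X, so only elements of bounded
   degree remain. *)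
- move=> X; pose i := Num.bound `|X|.
  have Xi : X < i%:R by apply: le_lt_trans (ler_norm X) (archi_boundP (normr_ge0 X)).
  apply: sub_finite_set (northcott_bounded X (tower_deg dd i) hgamma0) => a [/= /asboolP La aX].
  split=> //; have [ai|nai] := pselect (tower dd pp i a).
    have [q [q0 sq rq]] := qspan_alg (Kq i) (tower_span dd pp i) ai.
    exact: alg_deg_le q0 sq rq.
  have [j ij [aj naj]] := tower_step dpP La nai.
  have [/= dpr ppr Dd pd [B0 iB _]] := fP (tower_deg dd j, j) (D0 j).
  have := weighted_height_lower hgamma1 (Kq j) (tower_span dd pp j) (D0 j) dpr ppr Dd pd
    (tower_rootX dpP j) aj naj B0.
  move=> h; have := le_trans iB (le_trans h aX); rewrite leNgt => /negP; case.
  by apply: lt_le_trans Xi _; rewrite ler_nat.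
- apply; apply: limit_point0P => e e0.
  (* The weighted height of [tower_root i] is positive and at most 1/(i + 1), which is below e for
     this i. *)
  pose i := Num.bound e^-1.
  have [/= dpr ppr Dd pd [_ _ small]] := fP (tower_deg dd i, i) (D0 i).
  exists (weighted_height (gamma - epsilon) (tower_root dd pp i)).
    exists (tower_root dd pp i) => //=; apply/asboolP.
    by exists i.+1 => //; apply: tower_root_in.
  rewrite (radical_weighted_height dpr ppr (tower_rootX dpP i)); apply/andP; split.
    rewrite mulr_gt0 ?powR_gt0 ?ltr0n ?prime_gt0 //.
    by rewrite ln_gt0 // ltr1n prime_gt1.
  apply: le_lt_trans small _; rewrite -[ltRHS]invrK ltf_pV2 ?posrE ?invr_gt0 //.
  have e1 : 0 <= e^-1 by rewrite invr_ge0 ltW.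
  by apply: lt_le_trans (archi_boundP e1) _; rewrite ler_nat.
Qed.
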